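(* Let $d\in\mathbb{N}$, $\kappa\in(0,\infty)$, let $(\Omega,\mathcal{F},\mathbb{P})$ be a probability space, and let $X_{n,m}\colon\Omega\to\mathbb{R}^d$, $(n,m)\in\mathbb{Z}^2$, be non-degenerate i.i.d. random variables. Let $\mathfrak{l}\colon\mathbb{R}^d\times\mathbb{R}^d\to\mathbb{R}$ satisfy $\mathfrak{l}(\theta,x) = \kappa\|\theta-x\|^2$ for all $\theta,x\in\mathbb{R}^d$. Let $M,\mathfrak{M}\in\mathbb{N}$ and let $\Theta\colon\mathbb{N}_0\times\Omega\to\mathbb{R}^d$ and $\gamma\colon\mathbb{N}\times\Omega\to\mathbb{R}$ be stochastic processes such that for all $n\in\mathbb{N}$ $$\Theta_n = \Theta_{n-1} - \frac{\gamma_n}{M}\Big[\sum_{m=1}^M(\nabla_\theta\mathfrak{l})(\Theta_{n-1},X_{n,m})\Big].$$ Let $(\nu_n)_{n\in\mathbb{N}}\subseteq\mathbb{R}$ be strictly decreasing with $\limsup_{n\to\infty}\nu_n = 0$ and $\sum_{n=1}^\infty\nu_n=\infty$. Assume $\gamma_1=\nu_1<\kappa^{-1}$ and for all $n\in\mathbb{N}$ $$\gamma_{n+1} = \begin{cases} \gamma_n & \text{if } \sum_{m=1}^{\mathfrak{M}} \mathfrak{l}(\Theta_n, X_{n,-m}) \le \sum_{m=1}^{\mathfrak{M}} \mathfrak{l}(\Theta_{n-1}, X_{n,-m}),\\ \max\big((0,\gamma_n)\cap \{\nu_k\colon k\in\mathbb{N}\}\big) & \text{if } \sum_{m=1}^{\mathfrak{M}}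 \mathfrak{l}(\Theta_n, X_{n,-m}) > \sum_{m=1}^{\mathfrak{M}} \mathfrak{l}(\Theta_{n-1}, X_{n,-m}).\end{cases}$$ For every $t\in[0,\infty)$ let $N_t=\inf\{n\in\mathbb{N}_0\colon\sum_{k=1}^n\gamma_k\ge t\}$. Assume that $(X_{n,m})_{(n,m)\in\mathbb{Z}^2}$ and $\Theta_0$ are independent and that $\mathbb{E}\big[\|\Theta_0\|^2 + \sup_{n\in\mathbb{N}}\|X_{n,0}\|\big]<\infty$. Then $$\limsup_{t\to\infty}\mathbb{E}\big[\|\Theta_{N_t}-\mathbb{E}[X_{1,1}]\|^2\big]=0.$$
   Context: $\|\cdot\|$ is the Euclidean norm. For a Borel measure $\mu$ on $\mathbb{R}^d$, its support is $\operatorname{supp}(\mu)=\{x\in\mathbb{R}^d\colon \mu(A)>0 \text{ for every open } A\ni x\}$. For a random variable $X$ with values in $\mathbb{R}^d$, $\operatorname{supp}(X)=\operatorname{supp}(\mathbb{P}_X)$ where $\mathbb{P}_X$ is the law of $X$. A random variable $X$ is called non-degenerate if the interior of $\operatorname{supp}(X)$ is non-empty. *)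

(* Defs.v *)
From HB Require Import structures.
From mathcomp Require Import all_boot all_order all_algebra.
From mathcomp Require Import all_classical all_reals all_analysis.
Set Implicit Arguments. Unset Strict Implicit. Unset Printing Implicit Defensive.
Import Order.TTheory GRing.Theory Num.Theory.
Import numFieldNormedType.Exports.
Local Open Scope classical_set_scope.
Local Open Scope ring_scope.

Definition enorm (R : realType) (d : nat) (v : 'rV[R]_d) : R :=
  Num.sqrt (\sum_(i < d) (v ord0 i) ^+ 2).

Definition grad (R : realType) (d : nat) (f : 'rV[R]_d -> R) (th : 'rV[R]_d)
  : 'rV[R]_d := \row_(i < d) ('D_(delta_mx 0 i) f th).

Definition borelRd (R : realType) (d : nat) : set (set 'rV[R]_d) :=
  <<s open >>.

Definition rvRd (R : realType) (dT : measure_display) (T : measurableType dT)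
  (d : nat) (X : T -> 'rV[R]_d) : Prop :=
  forall A, borelRd A -> measurable (X @^-1` A).

Definition sigma_of (R : realType) (dT : measure_display) (T : measurableType dT)
  (d : nat) (X : T -> 'rV[R]_d) : set (set T) :=
  [set X @^-1` A | A in borelRd (R:=R) (d:=d)].

Definition supp_rv (R : realType) (dT : measure_display) (T : measurableType dT)
  (P : probability T R) (d : nat) (X : T -> 'rV[R]_d) : set 'rV[R]_d :=
  [set x | forall A : set 'rV[R]_d, open A -> A x -> (0 < P (X @^-1` A))%E].

Definition nondegenerate_rv (R : realType) (dT : measure_display) (T : measurableType dT)
  (P : probability T R) (d : nat) (X : T -> 'rV[R]_d) : Prop :=
  interior (supp_rv P X) !=set0.

Definition mutually_independent (R : realType) (dT : measure_display)
  (T : measurableType dT) (P : probability T R) (I : eqType)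
  (F : I -> set (set T)) : Prop :=
  forall (J : seq I) (A : I -> set T), uniq J ->
    (forall j, j \in J -> F j (A j)) ->
    P (\big[setI/setT]_(j <- J) A j) = (\prod_(j <- J) P (A j))%E.

Definition independent2 (R : realType) (dT : measure_display)
  (T : measurableType dT) (P : probability T R) (G1 G2 : set (set T)) : Prop :=
  forall A B, G1 A -> G2 B -> P (A `&` B) = (P A * P B)%E.

Definition ident_distr (R : realType) (dT : measure_display) (T : measurableType dT)
  (P : probability T R) (d : nat) (X Y : T -> 'rV[R]_d) : Prop :=
  forall A, borelRd A -> P (X @^-1` A) = P (Y @^-1` A).

(* the first n in N_0 satisfying p (the infimum); 0 if there is none *)
Definition first_hit (p : pred nat) : nat :=
  match pselect (exists n, p n) with
  | left h => ex_minn h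
  | right _ => 0%N
  end.

Definition Nt (R : realType) (T : Type) (gamma : nat -> T -> R) (t : R) (w : T) : nat :=
  first_hit (fun n => t <= \sum_(1 <= k < n.+1) gamma k w).

Definition meanRd (R : realType) (dT : measure_display) (T : measurableType dT)
  (P : probability T R) (d : nat) (X : T -> 'rV[R]_d) : 'rV[R]_d :=
  \row_(i < d) fine (\int[P]_w (X w ord0 i)%:E)%E.

(* Main.v *)
(* The SGD step reads Theta_n = (1 - a) Theta_(n-1) + a Xbar_n with a = 2 kappa gamma_n in (0, 2),
   and gamma_n = nu_k where k - 1 is the number of loss increases before time n.

   The steps tend to 0 almost surely.  Integrability of the supremum makes the X bounded, so while
   gamma is constant Theta stays bounded.  The support contains a ball around some x0; independent
   blocks of samples contain infinitely often a run near x0, which brings Theta near x0, followed by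
   a batch near x0 + rho e and evaluation points near x0 - rho e.  Such a block forces an increase of
   the evaluation loss, so gamma cannot stay constant forever.

   For the error D_n = Theta_n - E X and S_n = gamma_1 + ... + gamma_n, the process
   exp (c (S_n - t)) |D_n|^2 stopped at N_t is a supermartingale up to increments
   O(exp (c (S_n - t)) gamma_n^2): gamma_n depends on the past only and the cross term has mean 0.
   Hence E|D_(N_t)|^2 <= A(k) exp (- c t) + b E[gamma_k] for every k: the first k increments carry
   the factor exp (- c t), and the sum of the others is at most gamma_k times a bounded Riemann sum.
   Let t and then k tend to infinity.  As gamma_n >= nu_n, N_t is bounded by a deterministic
   index, so no optional stopping theorem is needed. *)
Require Import Defs.
From HB Require Import structures.
From mathcomp Require Import all_boot all_order all_algebra.
From mathcomp Require Import all_classical all_reals all_analysis.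
From mathcomp Require Import measurable_realfun ring lra zify.
Set Implicit Arguments. Unset Strict Implicit. Unset Printing Implicit Defensive.
Import Order.TTheory GRing.Theory Num.Theory.
Import numFieldNormedType.Exports.
Local Open Scope classical_set_scope.
Local Open Scope ring_scope.

(** * Independence *)

Section independence.
Context {dT : measure_display} {T : measurableType dT} {R : realType}.
Variable P : probability T R.

(** Dynkin's pi-lambda argument: the events independent of [B] form a lambda-system, which contains
    the sigma-algebra generated by the pi-system [H]. *)
Lemma indep_g_sigma_algebra (H : set (set T)) (B : set T) :
  setI_closed H -> H `<=` measurable -> measurable B ->
  (forall A, H A -> P (A `&` B) = (P A * P B)%E) ->
  forall A, <<s H >> A -> P (A `&` B) = (P A * P B)%E.
Proof.
move=> HI Hm mB HB A sA.
have sHm : <<s H >> `<=` measurable by apply: smallest_sub => //; exact: sigma_algebra_measurable.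
pose Q : set (set T) := [set A | measurable A /\ P (A `&` B) = (P A * P B)%E].
suff: <<s H >> `<=` Q by move=> /(_ _ sA)[].
apply: lambda_system_subset => //; last by move=> C HC; split; [exact: Hm|exact: HB].
apply/dynkin_lambda_system; split.
- by split => //; rewrite setTI probability_setT mul1e.
- move=> C [mC PC]; split; first exact: measurableC.
  rewrite setIC -setDE measureD//; last by rewrite -ge0_fin_numE// fin_num_measure.
  transitivity (P B - P C * P B)%E.
    by congr (_ - _)%E; rewrite setIC; exact: PC.
  rewrite probability_setC// muleBl ?mul1e//.
    exact: fin_num_measure.
- move=> F tF QF; have mF n : measurable (F n) by have [] := QF n.
  split; first exact: bigcup_measurable.
  have -> : P (\bigcup_k F k) = (\sum_(0 <= k <oo) P (F k))%E.
    rewrite measure_bigcup//; apply: eq_eseriesl => k; exact: in_setT.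
  have -> : P (\bigcup_k F k `&` B) = (\sum_(0 <= k <oo) P (F k `&` B))%E.
    rewrite setI_bigcupl measure_bigcup//.
    - by apply: eq_eseriesl => k; exact: in_setT.
    - by move=> k _; exact: measurableI.
    - exact: trivIset_setIr.
  rewrite -(fineK (fin_num_measure P _ mB)) muleC -nneseriesZl//.
  apply: eq_eseriesr => n _.
  by have [_ ->] := QF n; rewrite muleC fineK// fin_num_measure.
Qed.

(** A second Borel-Cantelli lemma: each further index multiplies the probability of avoiding all
    events since [n] by at most [1 - p]. Independence has the form this induction consumes, each
    event against the avoidance of those before it. *)
Lemma indep_seq_infinitely_often (E : nat -> set T) (p : R) :
  (forall j, measurable (E j)) -> 0 < p -> (forall j, p%:E <= P (E j))%E ->
  (forall n j, P (\big[setI/setT]_(n <= i < n + j) ~` E i `&` E (n + j)%N) =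
     (P (\big[setI/setT]_(n <= i < n + j) ~` E i) * P (E (n + j)%N))%E) ->
  {ae P, forall w, forall n, exists2 i, (n <= i)%N & E i w}.
Proof.
move=> mE p0 pE indE.
pose avoid n j := \big[setI/setT]_(n <= i < n + j) ~` E i.
have mav n j : measurable (avoid n j).
  by apply: bigsetI_measurable => i _; exact: measurableC.
have p1 : p <= 1 by rewrite -lee_fin (le_trans (pE 0%N))// probability_le1.
have avS n j : (P (avoid n j) <= ((1 - p) ^+ j)%:E)%E.
  elim: j => [|j IH]; first by rewrite expr0 probability_le1.
  rewrite /avoid addnS big_nat_recr/= ?leq_addr// -/(avoid n j).
  have fa : P (avoid n j) \is a fin_num by exact: fin_num_measure.
  have fE : P (E (n + j)%N) \is a fin_num by exact: fin_num_measure.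
  have -> : P (avoid n j `&` ~` E (n + j)%N) =
      (P (avoid n j) - P (avoid n j) * P (E (n + j)%N))%E.
    rewrite -setDE measureD//; last by rewrite -ge0_fin_numE.
    by congr (_ - _)%E; exact: indE.
  have : 0 <= fine (P (avoid n j)) by rewrite fine_ge0.
  move: IH (pE (n + j)%N).
  rewrite -(fineK fa) -(fineK fE).
  move: (fine (P (avoid n j))) (fine (P (E _))) => u v; rewrite -EFinM -EFinB !lee_fin => IH pv /= u0.
  rewrite exprS; apply: (@le_trans _ _ ((1 - p) * u)); last first.
    by rewrite ler_wpM2l// subr_ge0.
  have uv : 0 <= u * (v - p) by rewrite mulr_ge0// subr_ge0.
  by rewrite mulrBr in uv; lra.
apply/ae_foralln => n.
exists (\bigcap_(j in setT) avoid n j); split.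
- exact: bigcapT_measurable.
- apply/eqP; rewrite eq_le measure_ge0 andbT.
  have cv : ((1 - p) ^+ j)%:E @[j --> \oo] --> (0 : \bar R).
    apply: cvg_EFin; first by near=> j.
    by apply: cvg_expr; rewrite ger0_norm ?subr_ge0// ltrBlDr ltrDl.
  apply: (cvge_to_ge cv) => //.
    apply: nearW => j; apply: le_trans (avS n j).
    apply: le_measure; rewrite ?inE//; first exact: bigcapT_measurable.
    by move=> w; apply.
- move=> w /= nE j _; rewrite /avoid -bigcap_seq /= => i.
  rewrite /= mem_index_iota => /andP[ni _] Ei; apply: nE; by exists i.
Unshelve. all: by end_near. Qed.

(** Independence makes the law of [(Z, f)] the product of the marginal laws, by uniqueness of
    product measures; Fubini then factors the integral of [z.1 * z.2]. *)
Lemma integrable_indep_mul (Z f : T -> R) :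
  P.-integrable setT (EFin \o Z) -> P.-integrable setT (EFin \o f) ->
  (forall A B, measurable A -> measurable B ->
     P (Z @^-1` A `&` f @^-1` B) = (P (Z @^-1` A) * P (f @^-1` B))%E) ->
  P.-integrable setT (EFin \o (Z \* f)) /\
  \int[P]_w (Z w * f w) = \int[P]_w Z w * \int[P]_w f w.
Proof.
move=> iZ i_f ind.
have mZ : measurable_fun setT Z by apply/measurable_EFinP; case/integrableP: iZ.
have mf : measurable_fun setT f by apply/measurable_EFinP; case/integrableP: i_f.
pose mfZ : {mfun T >-> R} := HB.pack Z (isMeasurableFun.Build _ _ _ _ _ mZ).
pose mff : {mfun T >-> R} := HB.pack f (isMeasurableFun.Build _ _ _ _ _ mf).
have mZf : measurable_fun setT (fun w => (Z w, f w)) by exact: measurable_fun_pair.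
pose mfZf : {mfun T >-> (R * R)%type} := HB.pack (fun w => (Z w, f w)) (isMeasurableFun.Build _ _ _ _ _ mZf).
pose m1 := distribution P mfZ.
pose m2 := distribution P mff.
pose m := distribution P mfZf.
have mE A : measurable A -> (m1 \x m2)%E A = m A.
  apply: product_measure_unique => A1 B1 mA1 mB1.
  by rewrite /m1 /m2 /m /distribution /pushforward /= -ind.
pose g (z : R * R) := (z.1 * z.2)%:E.
have mg : measurable_fun setT g.
  by apply/measurable_EFinP; apply: measurable_funM => //; exact: measurable_fun_snd.
have ig12 : (m1 \x m2)%E.-integrable setT g.
  apply/integrable12ltyP => //.
  under eq_integral => x _.
    under eq_integral => y _ do rewrite /g /= normrM EFinM.
    rewrite ge0_integralZl//; last by do 2 apply: measurableT_comp => //.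
    over.
  rewrite /= ge0_integralZr//; last 2 first.
  - by do 2 apply: measurableT_comp => //.
  - exact: integral_ge0.
  rewrite !ge0_integral_pushforward//; last 2 first.
  - by do 2 apply: measurableT_comp => //.
  - by do 2 apply: measurableT_comp => //.
  apply: lte_mul_pinfty.
  - by apply: integral_ge0 => x _ /=; rewrite lee_fin.
  - rewrite ge0_fin_numE; first by case/integrableP: iZ.
    by apply: integral_ge0 => x _ /=; rewrite lee_fin.
  - by case/integrableP: i_f.
have ig : P.-integrable setT (EFin \o (Z \* f)).
  apply/integrableP; split.
    by apply/measurable_EFinP; exact: measurable_funM.
  have := ig12 => /integrableP[_].
  rewrite (eq_measure_integral m); last by move=> A mA _; exact: mE.
  rewrite ge0_integral_pushforward//; exact: measurableT_comp.
split => //.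
rewrite /Rintegral -fineM; try exact: integrable_fin_num.
congr fine.
transitivity (\int[m]_z g z)%E.
  by rewrite integral_pushforward.
transitivity (\int[m1 \x m2]_z g z)%E.
  by apply: eq_measure_integral => A mA _; apply/esym/mE.
rewrite -integral12_prod_meas1//.
have if2 : m2.-integrable setT (EFin \o id).
  by apply: (@integrable_pushforward _ _ _ _ _ _ mf P setT (EFin \o id)) => //; exact/measurable_EFinP.
have if1 : m1.-integrable setT (EFin \o id).
  by apply: (@integrable_pushforward _ _ _ _ _ _ mZ P setT (EFin \o id)) => //; exact/measurable_EFinP.
have i2 : (\int[m2]_y y%:E = \int[P]_w (f w)%:E)%E.
  by rewrite (@integral_pushforward _ _ _ _ _ _ mf P setT EFin).
have i1 : (\int[m1]_y y%:E = \int[P]_w (Z w)%:E)%E.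
  by rewrite (@integral_pushforward _ _ _ _ _ _ mZ P setT EFin).
transitivity (\int[m1]_x (x%:E * \int[m2]_y y%:E))%E.
  apply: eq_integral => x _; rewrite /fubini_F /g /=.
  by under eq_integral do rewrite EFinM; rewrite integralZl.
by rewrite i2 -(fineK (integrable_fin_num measurableT i_f)) integralZr// i1.
Qed.

(** * Integrability and linearity of real-valued expectations *)

Lemma integrable_EFin_cst (k : R) : P.-integrable setT (EFin \o (fun=> k)).
Proof. exact: finite_measure_integrable_cst. Qed.

Lemma Rintegral_EFin_cst (k : R) : \int[P]_w k = k.
Proof.
rewrite Rintegral_cst// (_ : fine _ = 1) ?mulr1//.
by transitivity (fine (1%E : \bar R)) => //; congr fine; exact: probability_setT.
Qed.

Lemma integrable_RD (f g : T -> R) :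
  P.-integrable setT (EFin \o f) -> P.-integrable setT (EFin \o g) ->
  P.-integrable setT (EFin \o (fun w => f w + g w)).
Proof. by move=> i_f ig; exact: (integrableD measurableT i_f ig). Qed.

Lemma integrable_RZl (k : R) (f : T -> R) : P.-integrable setT (EFin \o f) ->
  P.-integrable setT (EFin \o (fun w => k * f w)).
Proof. by move=> i_f; exact: (integrableZl measurableT k i_f). Qed.

Lemma integrable_ae_bounded (f : T -> R) (C : R) : measurable_fun setT f ->
  {ae P, forall w, `|f w| <= C} -> P.-integrable setT (EFin \o f).
Proof.
move=> mf fC; apply/integrableP; split; first exact/measurable_EFinP.
apply: (@le_lt_trans _ _ (\int[P]_w `|C|%:E)%E); last first.
  by have /integrableP[] := integrable_EFin_cst C.
apply: ae_ge0_le_integral => //.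
- by apply: measurableT_comp => //; exact/measurable_EFinP.
- by apply: filterS fC => w fC _; rewrite /= lee_fin (le_trans fC)// ler_norm.
Qed.

Lemma integrable_Rsum (I : Type) (r : seq I) (f : I -> T -> R) :
  (forall m, P.-integrable setT (EFin \o f m)) ->
  P.-integrable setT (EFin \o (fun w => \sum_(m <- r) f m w)).
Proof.
move=> i_f; rewrite (_ : EFin \o _ = fun w => \sum_(m <- r) (f m w)%:E)%E; last first.
  by apply/funext => w; rewrite /= sumEFin.
by apply: integrable_sum => // m _; exact: i_f.
Qed.

Lemma Rintegral_sum (I : Type) (r : seq I) (f : I -> T -> R) :
  (forall m, P.-integrable setT (EFin \o f m)) ->
  \int[P]_w (\sum_(m <- r) f m w) = \sum_(m <- r) \int[P]_w f m w.
Proof.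
move=> i_f; elim: r => [|m r IH].
  by under eq_Rintegral do rewrite big_nil; rewrite Rintegral_cst// mul0r big_nil.
under eq_Rintegral do rewrite big_cons.
by rewrite RintegralD// ?IH ?big_cons//; exact: integrable_Rsum.
Qed.

End independence.

(** * The sigma-algebra of the past *)

Section past.
Context {dT : measure_display} {T : measurableType dT} {R : realType}.
Variables (P : probability T R) (d : nat) (X : int * int -> T -> 'rV[R]_d).
Variable Y : T -> 'rV[R]_d.

Definition cylinder (J : seq (int * int)) : set (set T) :=
  [set A | exists2 B : int * int -> set 'rV[R]_d, forall j, borelRd (B j) &
             A = \big[setI/setT]_(j <- J) X j @^-1` B j].

(** A pi-system of rectangles generating the sigma-algebra of [Y] and the [X j] with [j] in [J]; it
    is kept apart from that sigma-algebra so that [indep_g_sigma_algebra] applies. *)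
Definition past (J : seq (int * int)) : set (set T) :=
  [set A | exists C B, [/\ cylinder J C, borelRd B & A = C `&` Y @^-1` B]].

Lemma borelRdI (A B : set 'rV[R]_d) : borelRd A -> borelRd B -> borelRd (A `&` B).
Proof.
move=> mA mB.
exact: (@measurableI _ (g_sigma_algebraType (@open 'rV[R]_d)) A B mA mB).
Qed.

Lemma borelRdT : borelRd (setT : set 'rV[R]_d).
Proof. exact: (@measurableT _ (g_sigma_algebraType (@open 'rV[R]_d))). Qed.

Lemma borelRd_open (A : set 'rV[R]_d) : open A -> borelRd A.
Proof. exact: sub_sigma_algebra. Qed.

Lemma borelRd_coord (i : 'I_d) (A : set R) : measurable A ->
  borelRd ((fun x : 'rV[R]_d => x ord0 i) @^-1` A).
Proof.
move=> mA; rewrite -[_ @^-1` _]setTI.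
have : measurable_fun (setT : set (g_sigma_algebraType (@open 'rV[R]_d)))
         (fun x : 'rV[R]_d => x ord0 i).
  apply: (measurability _ (RGenOInfty.measurableE R)) => _ [_ [a ->] <-].
  apply: sub_sigma_algebra; rewrite setTI.
  apply: (@open_comp 'rV[R]_d R (fun x : 'rV[R]_d => x ord0 i)).
    by move=> x _; exact: coord_continuous.
  by apply: interval_open.
by move=> /(_ measurableT _ mA).
Qed.

Hypothesis mX : forall j, rvRd (X j).
Hypothesis mY : rvRd Y.

Lemma cylinder_measurable J : cylinder J `<=` measurable.
Proof.
by move=> A [B mB ->]; apply: bigsetI_measurable => j _; exact: mX.
Qed.

Lemma past_measurable J : past J `<=` measurable.
Proof.
move=> A [C [B [cC mB ->]]]; apply: measurableI; last exact: mY.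
exact: cylinder_measurable cC.
Qed.

Lemma past_setI_closed J : setI_closed (past J).
Proof.
move=> _ _ [_ [B1 [[C1 mC1 ->] mB1 ->]]] [_ [B2 [[C2 mC2 ->] mB2 ->]]].
exists (\big[setI/setT]_(j <- J) X j @^-1` (C1 j `&` C2 j)), (B1 `&` B2); split.
- by exists (fun j => C1 j `&` C2 j) => // j; exact: borelRdI.
- exact: borelRdI.
- by rewrite preimage_setI setIACA -big_split.
Qed.

Lemma sub_past_measurable_fun {d'} {U : measurableType d'} J (f : T -> U) :
  measurable_fun (setT : set (g_sigma_algebraType (past J))) f ->
  measurable_fun setT f.
Proof.
move=> mf _ B mB; have := mf measurableT B mB; apply: smallest_sub.
  exact: sigma_algebra_measurable.
exact: past_measurable.
Qed.

Lemma past_measurable_coord J j i : j \in J ->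
  measurable_fun (setT : set (g_sigma_algebraType (past J))) (fun w => X j w ord0 i).
Proof.
move=> jJ _ B mB; rewrite setTI; apply: sub_sigma_algebra.
exists (X j @^-1` ((fun x : 'rV[R]_d => x ord0 i) @^-1` B)), setT; split.
- exists (fun k => if k == j then (fun x : 'rV[R]_d => x ord0 i) @^-1` B else setT).
    by move=> k; case: ifP => _; [exact: borelRd_coord|exact: borelRdT].
  apply/seteqP; split => w.
    rewrite -bigcap_seq => Bw k kJ; case: eqP => [->//|//].
  by rewrite -bigcap_seq => /(_ j jJ); rewrite eqxx.
- exact: borelRdT.
- by rewrite preimage_setT setIT.
Qed.

Lemma past_measurable_initial J i :
  measurable_fun (setT : set (g_sigma_algebraType (past J))) (fun w => Y w ord0 i).
Proof.
move=> _ B mB; rewrite setTI; apply: sub_sigma_algebra.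
exists setT, ((fun x : 'rV[R]_d => x ord0 i) @^-1` B); split.
- exists (fun=> setT); first by move=> _; exact: borelRdT.
  by rewrite big1.
- exact: borelRd_coord.
- by rewrite setTI.
Qed.

Hypothesis indX : mutually_independent P (fun j => sigma_of (X j)).
Hypothesis indY : independent2 P <<s \bigcup_j sigma_of (X j) >> (sigma_of Y).

Lemma cylinder_sigma J : cylinder J `<=` <<s \bigcup_j sigma_of (X j) >>.
Proof.
move=> _ [B mB ->].
pose G := \bigcup_j sigma_of (X j).
apply: (@bigsetI_measurable _ (g_sigma_algebraType G)) => j _.
by apply: sub_sigma_algebra; exists j => //; exists (B j).
Qed.

Lemma cylinder_prob J B : uniq J -> (forall j, borelRd (B j)) ->
  P (\big[setI/setT]_(j <- J) X j @^-1` B j) = (\prod_(j <- J) P (X j @^-1` B j))%E.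
Proof.
by move=> uJ mB; apply: indX => // j _; exists (B j).
Qed.

(** It suffices to test rectangles. There the factor of [Y] splits off by [indY], and the two
    cylinders merge into one over the duplicate-free list [J ++ J'], where mutual independence
    factors the probability. *)
Lemma past_indep J J' : uniq (J ++ J') -> forall A C, <<s past J >> A -> cylinder J' C ->
  P (A `&` C) = (P A * P C)%E.
Proof.
move=> uJ A C sA cC; move: A sA; apply: indep_g_sigma_algebra.
- exact: past_setI_closed.
- exact: past_measurable.
- exact: cylinder_measurable cC.
move=> _ [C1 [B0 [cC1 mB0 ->]]].
have sB0 : sigma_of Y (Y @^-1` B0) by exists B0.
rewrite (indY (cylinder_sigma cC1) sB0).
have cCC : cylinder (J ++ J') (C1 `&` C) /\ P (C1 `&` C) = (P C1 * P C)%E.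
  move: cC cC1 uJ => [B' mB' ->] [B mB ->]; rewrite cat_uniq => /and3P[uJ /hasPn disj uJ'].
  have eqI : \big[setI/setT]_(j <- J) X j @^-1` B j `&` \big[setI/setT]_(j <- J') X j @^-1` B' j
    = \big[setI/setT]_(j <- J ++ J') X j @^-1` (if j \in J then B j else B' j).
    rewrite big_cat; congr setI.
      by apply: eq_big_seq => j ->.
    by apply: eq_big_seq => j /disj /negPf ->.
  have mif j : borelRd (if j \in J then B j else B' j) by case: ifP.
  split.
    by rewrite eqI; exists (fun j => if j \in J then B j else B' j).
  rewrite eqI !cylinder_prob//; last by rewrite cat_uniq uJ uJ' andbT; exact/hasPn.
  rewrite big_cat; congr (_ * _)%E.
    by apply: eq_big_seq => j ->.
  by apply: eq_big_seq => j /disj /negPf ->.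
rewrite setIAC (indY (cylinder_sigma cCC.1) sB0).
by rewrite cCC.2 muleAC.
Qed.

(** The form in which independence enters the Lyapunov estimate: [Z] is a coefficient known from the
    past and [X j] is a fresh sample. *)
Lemma past_integrable_mul J j i (Z : T -> R) (g : R -> R) :
  uniq J -> j \notin J ->
  measurable_fun (setT : set (g_sigma_algebraType (past J))) Z ->
  measurable_fun setT g ->
  P.-integrable setT (EFin \o Z) ->
  P.-integrable setT (EFin \o (fun w => g (X j w ord0 i))) ->
  P.-integrable setT (EFin \o (fun w => Z w * g (X j w ord0 i))) /\
  \int[P]_w (Z w * g (X j w ord0 i)) = \int[P]_w Z w * \int[P]_w g (X j w ord0 i).
Proof.
move=> uJ jJ mZ mg iZ ig; apply: integrable_indep_mul => // A B mA mB.
apply: (@past_indep J [:: j]).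
- by rewrite cat_uniq uJ/= orbF andbT.
- by have := mZ measurableT A mA; rewrite setTI.
- exists (fun=> (fun x : 'rV[R]_d => x ord0 i) @^-1` (g @^-1` B)).
    move=> _; apply: borelRd_coord; rewrite -[_ @^-1` _]setTI; exact: mg.
  by rewrite big_seq1.
Qed.

End past.

(** * Recurrence of patterns in an i.i.d. array *)

(** Both signs occur: positive second indices feed the gradient batches, negative ones the
    evaluation losses. *)
Definition offsets (B : nat) : seq int := [seq m%:Z - B%:Z | m <- iota 0 (B + B).+1].

(* The indices (k, m) with a < k <= b and |m| <= B. *)
Definition block (B a b : nat) : seq (int * int) :=
  [seq (k%:Z, m) | k <- iota a.+1 (b - a), m <- offsets B].

Lemma mem_offsets B m : (m \in offsets B) = (- B%:Z <= m <= B%:Z).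
Proof.
apply/mapP/idP => [[k]|mB].
  rewrite mem_iota add0n => kB ->; lia.
exists (absz (m + B%:Z)); last by lia.
  by rewrite mem_iota; lia.
Qed.

Lemma mem_block B a b (k : nat) m :
  ((k%:Z, m) \in block B a b) = (a < k <= b)%N && (- B%:Z <= m <= B%:Z).
Proof.
rewrite -mem_offsets; apply/allpairsP/idP => [[[k' m']] /= [+ mB [-> ->]]|].
  by rewrite mB andbT mem_iota; lia.
move=> /andP[kab mB]; exists (k, m); split => //=; rewrite mem_iota; lia.
Qed.

Lemma uniq_block B a b : uniq (block B a b).
Proof.
apply: allpairs_uniq; first exact: iota_uniq.
  by rewrite map_inj_uniq ?iota_uniq// => x y; lia.
by move=> [k m] [k' m'] _ _ /= [-> ->].
Qed.

Lemma uniq_block_cat B a b : uniq (block B 0 a ++ block B a b).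
Proof.
rewrite cat_uniq !uniq_block/= andbT; apply/hasPn => _ /allpairsP[[k m] /= [+ mB ->]].
rewrite mem_iota mem_block; lia.
Qed.

Section recurrence.
Context {dT : measure_display} {T : measurableType dT} {R : realType}.
Variables (P : probability T R) (d : nat) (X : int * int -> T -> 'rV[R]_d).
Variable Y : T -> 'rV[R]_d.
Hypothesis mX : forall j, rvRd (X j).
Hypothesis mY : rvRd Y.
Hypothesis idX : forall j, ident_distr P (X j) (X (1%:Z, 1%:Z)).
Hypothesis indX : mutually_independent P (fun j => sigma_of (X j)).
Hypothesis indY : independent2 P <<s \bigcup_j sigma_of (X j) >> (sigma_of Y).

(** Time is cut into disjoint blocks of length [L]. By the i.i.d. assumption each block shows the
    pattern [V] with the same positive probability [p], a finite product, so the Borel-Cantelli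
    argument applies. *)
Lemma block_pattern_infinitely_often (L B : nat) (V : nat -> int -> set 'rV[R]_d) :
  (forall i m, borelRd (V i m)) ->
  (forall i m, 0 < P (X (1%:Z, 1%:Z) @^-1` V i m))%E ->
  {ae P, forall w, forall n, exists2 j, (n <= j)%N &
    forall i m, (i < L)%N -> - B%:Z <= m <= B%:Z ->
      V i m (X ((j * L + i).+1%:Z, m) w)}.
Proof.
move=> mV V0.
(* Positions inside block [j] are counted from its first time, [(j * L).+1]. *)
pose V' j (x : int * int) := V (absz x.1 - (j * L).+1)%N x.2.
pose E j := \big[setI/setT]_(x <- block B (j * L) (j * L + L)) X x @^-1` V' j x.
have cE j : cylinder X (block B (j * L) (j * L + L)) (E j).
  by exists (V' j) => // x; exact: mV.
have mE j : measurable (E j) by exact: (cylinder_measurable mX (cE j)).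
pose pr i m := fine (P (X (1%:Z, 1%:Z) @^-1` V i m)).
have prE i m : P (X (1%:Z, 1%:Z) @^-1` V i m) = (pr i m)%:E.
  by rewrite /pr fineK// fin_num_measure//; exact: mX.
pose p := \prod_(i <- iota 0 L) \prod_(m <- offsets B) pr i m.
have p0 : 0 < p.
  apply: prodr_gt0 => i _; apply: prodr_gt0 => m _.
  by rewrite -lte_fin -prE.
have PE j : P (E j) = p%:E.
  rewrite (cylinder_prob indX)//; last 2 first.
  - exact: uniq_block.
  - by move=> x; exact: mV.
  transitivity (\prod_(x <- block B (j * L) (j * L + L)) (pr (absz x.1 - (j * L).+1)%N x.2)%:E)%E.
    by apply: eq_bigr => x _; rewrite (idX x (mV _ _)) prE.
  rewrite prodEFin /block big_allpairs_dep; congr EFin.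
  have -> : iota (j * L).+1 (j * L + L - j * L) = [seq ((j * L).+1 + i)%N | i <- iota 0 L].
    by rewrite addKn -iotaDl addn0.
  rewrite big_map; apply: eq_bigr => i _.
  by apply: eq_bigr => m _; rewrite /= addKn.
have := @indep_seq_infinitely_often _ _ _ P E p mE p0.
have pE j : (p%:E <= P (E j))%E by rewrite PE.
move=> /(_ pE) ioE.
have : {ae P, forall w n, exists2 i, (n <= i)%N & E i w}.
  apply: ioE => n j.
  (* Avoiding the pattern in the blocks before [n + j] is an event of the past up to time
     [(n + j) * L], and block [n + j] uses only later samples. *)
  apply: (past_indep mX mY indX indY (uniq_block_cat B ((n + j) * L) ((n + j) * L + L))); last exact: cE.
  pose G := past X Y (block B 0 ((n + j) * L)).
  rewrite big_seq; apply: (@bigsetI_measurable _ (g_sigma_algebraType G)) => i.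
  rewrite mem_index_iota => /andP[ni inj].
  apply: (@measurableC _ (g_sigma_algebraType G)).
  rewrite /E big_seq; apply: (@bigsetI_measurable _ (g_sigma_algebraType G)) => x xb.
  apply: sub_sigma_algebra; exists (X x @^-1` V' i x), setT; split.
  - exists (fun y => if y == x then V' i x else setT).
      by move=> y; case: ifP => _; [exact: mV|exact: borelRdT].
    have xJ : x \in block B 0 ((n + j) * L).
      move: xb => /allpairsP[[k m] /= [+ mB ->]].
      rewrite mem_block -mem_offsets mB andbT mem_iota; nia.
    apply/seteqP; split => w.
      rewrite -bigcap_seq => Bw y yJ; case: eqP => [->//|//].
    by rewrite -bigcap_seq => /(_ x xJ); rewrite eqxx.
  - exact: borelRdT.
  - by rewrite preimage_setT setIT.
apply: filterS => w Ew n; have [j nj Ej] := Ew n; exists j => // i m iL mB.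
move: Ej; rewrite /E -bigcap_seq => /(_ ((j * L + i).+1%:Z, m)).
rewrite /V' /= mem_block => /(_ _)/=.
rewrite (_ : (j * L + i).+1 - (j * L).+1 = i)%N; last by lia.
by apply; rewrite mB andbT; lia.
Qed.

(** * Coordinates, norms and almost sure boundedness of the samples *)

Lemma rvRd_coord (Z : T -> 'rV[R]_d) i : rvRd Z -> measurable_fun setT (fun w => Z w ord0 i).
Proof.
move=> mZ _ B mB; rewrite setTI.
exact: (mZ ((fun x : 'rV[R]_d => x ord0 i) @^-1` B)) (borelRd_coord _ _).
Qed.

Lemma Rintegral_ident_distr j i (g : R -> R) : measurable_fun setT g ->
  (forall j, P.-integrable setT (EFin \o (fun w => g (X j w ord0 i)))) ->
  \int[P]_w g (X j w ord0 i) = \int[P]_w g (X (1%:Z, 1%:Z) w ord0 i).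
Proof.
move=> mg ig; rewrite /Rintegral; congr fine.
have mXi j' : measurable_fun setT (fun w => X j' w ord0 i) by exact: rvRd_coord.
pose m j' := distribution P (HB.pack (fun w => X j' w ord0 i)
  (isMeasurableFun.Build _ _ _ _ _ (mXi j')) : {mfun T >-> R}).
have mE j' : (\int[m j']_y (g y)%:E = \int[P]_w (g (X j' w ord0 i))%:E)%E.
  rewrite (@integral_pushforward _ _ _ _ _ _ (mXi j') P setT (EFin \o g))//.
    exact/measurable_EFinP.
  exact: ig.
rewrite -!mE; apply: eq_measure_integral => A mA _.
exact: (idX j (borelRd_coord i mA)).
Qed.

Lemma enorm_coord (x : 'rV[R]_d) i : `|x ord0 i| <= enorm x.
Proof.
rewrite /enorm -sqrtr_sqr ler_sqrt; last by apply: sumr_ge0 => *; exact: sqr_ge0.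
by rewrite (bigD1 i)//= lerDl sumr_ge0// => *; exact: sqr_ge0.
Qed.

Lemma enorm_sqr (x : 'rV[R]_d) : (enorm x) ^+ 2 = \sum_(i < d) (x ord0 i) ^+ 2.
Proof. by rewrite sqr_sqrtr// sumr_ge0// => i _; exact: sqr_ge0. Qed.


Lemma measurable_enorm (Z : T -> 'rV[R]_d) : rvRd Z -> measurable_fun setT (fun w => enorm (Z w)).
Proof.
move=> mZ; apply: measurableT_comp; first by apply: continuous_measurable_fun; exact: sqrt_continuous.
apply: measurable_sum => i; apply: measurable_funX; exact: rvRd_coord.
Qed.

Lemma measurable_sqr_enorm_add_sup : measurable_fun setT (fun w =>
  ((enorm (Y w)) ^+ 2)%:E +
  ereal_sup [set (enorm (X (n%:Z, 0%:Z) w))%:E | n in [set n : nat | (1 <= n)%N]])%E.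
Proof.
apply: emeasurable_funD.
  by apply/measurable_EFinP/measurable_funX; exact: measurable_enorm.
apply: (measurable_fun_esups (f := fun n w => (enorm (X (n%:Z, 0%:Z) w))%:E) _ 1%N) => n.
by apply/measurable_EFinP; exact: measurable_enorm.
Qed.

(* The supremum of an unbounded i.i.d. sequence is infinite almost surely. *)
Lemma iid_bounded_of_integrable_sup :
  (\int[P]_w (((enorm (Y w)) ^+ 2)%:E +
       ereal_sup [set (enorm (X (n%:Z, 0%:Z) w))%:E | n in [set n : nat | (1 <= n)%N]])
     < +oo)%E ->
  exists C : R, {ae P, forall w, forall j i, `|X j w ord0 i| <= C}.
Proof.
move=> int_lt.
pose f n w := (enorm (X (n%:Z, 0%:Z) w))%:E.
pose box (N : nat) : set 'rV[R]_d :=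
  \big[setI/setT]_(i < d) (fun x : 'rV[R]_d => x ord0 i) @^-1` `[- N%:R, N%:R].
have mbox N : borelRd (box N).
  apply: (@bigsetI_measurable _ (g_sigma_algebraType (@open 'rV[R]_d))) => i _.
  exact: borelRd_coord.
have mboxC N : borelRd (~` box N).
  exact: (@measurableC _ (g_sigma_algebraType (@open 'rV[R]_d)) _ (mbox N)).
have boxP N x : box N x <-> forall i, `|x ord0 i| <= N%:R.
  rewrite /box -bigcap_seq; split=> [h i|h i _] /=.
    by have := h i; rewrite /= in_itv/= -ler_norml mem_index_enum; apply.
  by rewrite in_itv/= -ler_norml.
(* Either one box carries the common law, and a countable union over the indices gives the bound, or
   the complement of every box has positive probability and is visited by the sequence. *)
have [[N PN0]|unb] := pselect (exists N, P (X (1%:Z, 1%:Z) @^-1` ~` box N) = 0%E).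
  exists N%:R.
  suff : {ae P, forall w (n : nat), if unpickle n is Some j then box N (X j w) else True}.
    by apply: filterS => w h j i; have := h (pickle j); rewrite pickleK => /boxP.
  apply/ae_foralln => n; case: (unpickle n) => [j|]; last exact: aeW.
  exists (X j @^-1` ~` box N); split; first exact: mX.
    exact: etrans (idX j (mboxC N)) PN0.
  by [].
exfalso.
have Ppos N : (0 < P (X (1%:Z, 1%:Z) @^-1` ~` box N))%E.
  by rewrite lt0e measure_ge0 andbT; apply/eqP => h; apply: unb; exists N.
have io : {ae P, forall w N, exists2 n, (1 <= n)%N & N%:R < enorm (X (n%:Z, 0%:Z) w)}.
  apply/ae_foralln => N.
  have := block_pattern_infinitely_often 1 0 (fun=> fun=> mboxC N) (fun=> fun=> Ppos N).
  apply: filterS => w /(_ 0%N)[j _ /(_ 0%N 0)/(_ isT isT)] nb.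
  exists (j * 1 + 0).+1 => //; apply: contrapT => /negP; rewrite -leNgt => le.
  by apply: nb; apply/boxP => i; apply: le_trans le; exact: enorm_coord.
have esupE w : esups (f^~ w) 1%N =
  ereal_sup [set (enorm (X (n%:Z, 0%:Z) w))%:E | n in [set n : nat | (1 <= n)%N]] by [].
have esup0 w : (0 <= esups (f^~ w) 1%N)%E.
  by apply: (@le_trans _ _ (f 1%N w)); [rewrite lee_fin sqrtr_ge0|apply: ereal_sup_ubound; exists 1%N].
have ig : P.-integrable setT (fun w => ((enorm (Y w)) ^+ 2)%:E + esups (f^~ w) 1%N)%E.
  apply/integrableP; split; first exact: measurable_sqr_enorm_add_sup.
  under eq_integral.
    move=> w _; rewrite gee0_abs; last by rewrite adde_ge0// lee_fin sqr_ge0.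
    over.
  exact: int_lt.
(* An integrable function is finite almost everywhere, whereas the supremum is almost surely
   infinite; an almost sure contradiction makes the whole space a null set. *)
have [N [mN N0 sub]] : {ae P, forall w : T, False}.
  apply: filterS2 io (integrable_ae measurableT ig) => w inf /(_ I).
  suff -> : esups (f^~ w) 1%N = +oo%E by [].
  apply/eqyP => A A0; have [n n1 An] := inf (Num.truncn A).+1.
  apply: (@le_trans _ _ (f n w)); last by apply: ereal_sup_ubound; exists n.
  by rewrite lee_fin (le_trans _ (ltW An))// ltW// truncnS_gt.
have := probability_setT P; rewrite (_ : setT = N); last first.
  by apply/seteqP; split => // w _; apply: sub.
by rewrite N0 => /eqP; rewrite eq_sym onee_eq0.
Qed.


End recurrence.

(** * Paths of the adaptive scheme *)

(** The difference quotient in direction [i] is exactly [kappa * (2 * c + h)], where [c] is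
    coordinate [i] of [th - x]. *)
Lemma grad_quadratic (R : realType) (d : nat) (kappa : R) (l : 'rV[R]_d -> 'rV[R]_d -> R)
  (x th : 'rV[R]_d) (i : 'I_d) :
  (forall th x, l th x = kappa * (enorm (th - x)) ^+ 2) ->
  grad (fun th => l th x) th ord0 i = 2 * kappa * (th ord0 i - x ord0 i).
Proof.
move=> lE; rewrite mxE.
set c := th ord0 i - x ord0 i.
have eqD h : l (h *: delta_mx 0 i + th) x - l th x = h * (kappa * (2 * c + h)).
  rewrite !lE !enorm_sqr (bigD1 i)//= [X in _ - kappa * X](bigD1 i)//=.
  have -> : \sum_(j < d | j != i) ((h *: delta_mx 0 i + th - x) ord0 j) ^+ 2 =
            \sum_(j < d | j != i) ((th - x) ord0 j) ^+ 2.
    by apply: eq_bigr => j ji; rewrite !mxE eqxx (negPf ji)/= mulr0 add0r.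
  rewrite !mxE !eqxx/= mulr1 /c; ring.
apply: cvg_lim => //.
apply: (@cvg_trans _ ((fun h : R => kappa * (2 * c + h)) @ 0^')).
  apply: near_eq_cvg; near=> h.
  have h0 : h != 0 by near: h; exact: nbhs_dnbhs_neq.
  by rewrite /= eqD -[_ *: _]/(_ * _) mulKf.
rewrite (_ : 2 * kappa * c = kappa * (2 * c + 0)); last by ring.
apply: cvgMr; apply: cvgD; first exact: cvg_cst.
exact: cvg_within.
Unshelve. all: by end_near. Qed.

(* The index k such that gamma n = nu k, when b n tells whether the evaluation loss increased at
   time n. *)
Fixpoint stage (b : nat -> bool) (n : nat) : nat :=
  if n is n'.+1 then (stage b n' + ((0 < n')%N && b n'))%N else 1%N.

Lemma stageS b n : stage b n.+1 = (stage b n + ((0 < n)%N && b n))%N.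
Proof. by []. Qed.

Lemma stage_gt0 b n : (0 < stage b n)%N.
Proof. by elim: n => //= n; lia. Qed.

Lemma leq_stage b n : (0 < n)%N -> (stage b n <= n)%N.
Proof.
elim: n => // -[|n] IH _ //=.
by have := IH isT; rewrite /=; case: (b n.+1); lia.
Qed.

Lemma stage_nondecreasing b : {homo stage b : m n / (m <= n)%N}.
Proof.
apply: homo_leq => //; first exact: leq_trans.
by move=> n /=; exact: leq_addr.
Qed.

(** [b / (1 - q)] is the fixed point of [u |-> q * u + b], which closes the induction. *)
Lemma linear_recursion_le (R : realType) (q b : R) (u : nat -> R) (K : nat) :
  0 <= q < 1 -> 0 <= b ->
  (forall n, (n < K)%N -> u n.+1 <= q * u n + b) ->
  u K <= q ^+ K * u 0%N + b / (1 - q).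
Proof.
move=> /andP[q0 q1] b0; elim: K => [|K IH] uS.
  by rewrite expr0 mul1r lerDl divr_ge0// subr_ge0 ltW.
apply: le_trans (uS K (ltnSn K)) _.
have /(ler_wpM2l q0) IHK := IH (fun n nK => uS n (ltnW nK)).
have -> : b / (1 - q) = q * (b / (1 - q)) + b by field; lra.
by rewrite exprS; lra.
Qed.

(** Cauchy-Schwarz against the constant 1. It later bounds the square of a batch mean by the mean of
    the squares, without expanding cross terms. *)
Lemma sqr_sum_le (R : realType) (I : Type) (r : seq I) (y : I -> R) :
  (\sum_(m <- r) y m) ^+ 2 <= (size r)%:R * \sum_(m <- r) y m ^+ 2.
Proof.
elim: r => [|m r]; first by rewrite !big_nil expr0n mulr0.
rewrite !big_cons -[size (m :: r)]/((size r).+1) mulrSr.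
have Q0 : 0 <= \sum_(m <- r) y m ^+ 2 by rewrite sumr_ge0// => k _; exact: sqr_ge0.
set S := \sum_(m <- r) y m; set Q := \sum_(m <- r) y m ^+ 2 in Q0 *; set a := y m.
case: (size r) => [|n] IH.
  have S0 : S = 0 by apply/eqP; rewrite -sqrf_eq0 eq_le sqr_ge0 andbT (le_trans IH)// mul0r.
  by rewrite S0 addr0 add0r mul1r lerDl.
have n0 : 0 < n.+1%:R :> R by [].
move: (n.+1%:R) S Q a n0 Q0 IH => N S Q a n0 Q0 IH.
have aS : 2 * a * S <= N * a ^+ 2 + Q.
  rewrite -(ler_pM2l n0) -subr_ge0.
  rewrite (_ : _ - _ = (N * a - S) ^+ 2 + (N * Q - S ^+ 2)); last by ring.
  by rewrite addr_ge0 ?sqr_ge0// subr_ge0.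
rewrite -subr_ge0 (_ : _ - _ = (N * a ^+ 2 + Q - 2 * a * S) + (N * Q - S ^+ 2)); last by ring.
by rewrite addr_ge0// subr_ge0.
Qed.

Lemma mulr_lt1_of_lt_inv (R : realType) (a g : R) : 0 < a -> 0 < g < a^-1 -> 0 < a * g < 1.
Proof. by move=> a0 /andP[g0 ga]; rewrite mulr_gt0//= -(@divff _ a) ?gt_eqF// ltr_pM2l. Qed.

Section path.
Context {R : realType} {d : nat}.
Variables (M Mf : nat) (kappa : R) (l : 'rV[R]_d -> 'rV[R]_d -> R).
Variables (th : nat -> 'rV[R]_d) (x : int * int -> 'rV[R]_d).
Variables (gamma nu : nat -> R).

Definition batch_mean (y : int * int -> 'rV[R]_d) (n : nat) (i : 'I_d) : R :=
  (\sum_(1 <= m < M.+1) y (n%:Z, m%:Z) ord0 i) / M%:R.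

Definition loss_increase (n : nat) : bool :=
  \sum_(1 <= m < Mf.+1) l (th n.-1) (x (n%:Z, - m%:Z)) <
  \sum_(1 <= m < Mf.+1) l (th n) (x (n%:Z, - m%:Z)).

Hypothesis kappa0 : 0 < kappa.
Hypothesis M0 : (0 < M)%N.
Hypothesis Mf0 : (0 < Mf)%N.
Hypothesis lE : forall th x, l th x = kappa * (enorm (th - x)) ^+ 2.
Hypothesis sgd : forall n, th n.+1 = th n -
  (gamma n.+1 / M%:R) *: \sum_(1 <= m < M.+1) grad (fun th => l th (x (n.+1%:Z, m%:Z))) (th n).
Hypothesis nu_dec : forall n, (1 <= n)%N -> nu n.+1 < nu n.
Hypothesis nu_gt0 : forall n, (1 <= n)%N -> 0 < nu n.
Hypothesis nu1 : nu 1%N < kappa^-1.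
Hypothesis gamma1 : gamma 1%N = nu 1%N.
Hypothesis adapt : forall n, (1 <= n)%N ->
  let Lnew := \sum_(1 <= m < Mf.+1) l (th n) (x (n%:Z, - m%:Z)) in
  let Lold := \sum_(1 <= m < Mf.+1) l (th n.-1) (x (n%:Z, - m%:Z)) in
  (Lnew <= Lold -> gamma n.+1 = gamma n) /\
  (Lold < Lnew ->
     [/\ 0 < gamma n.+1, gamma n.+1 < gamma n,
         (exists2 k, (1 <= k)%N & gamma n.+1 = nu k) &
         (forall k, (1 <= k)%N -> 0 < nu k -> nu k < gamma n -> nu k <= gamma n.+1)]).

Lemma sgd_coord n i : th n.+1 ord0 i =
  th n ord0 i - 2 * kappa * gamma n.+1 * (th n ord0 i - batch_mean x n.+1 i).
Proof.
rewrite sgd !mxE summxE; congr (_ - _).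
under eq_bigr do rewrite (grad_quadratic _ _ _ lE).
rewrite -mulr_sumr sumrB sumr_const_nat subn1/= /batch_mean.
have : M%:R != 0 :> R by rewrite pnatr_eq0 -lt0n.
by move=> M0'; rewrite -mulr_natr; field.
Qed.

Lemma nu_mono : {in [pred n | 1 <= n]%N &, {mono nu : m n / (n < m)%N >-> m < n}}.
Proof.
have homo m n : (1 <= m)%N -> (m < n)%N -> nu n < nu m.
  move=> m1; elim: n => // n IH; rewrite ltnS leq_eqVlt => /orP[/eqP <-|mn].
    exact: nu_dec.
  by apply: lt_trans (IH mn); apply: nu_dec; exact: leq_trans mn.
move=> m n; rewrite !inE => m1 n1.
case: (ltngtP m n) => [mn|nm|->]; last by rewrite ltxx.
  by apply/negbTE; rewrite -leNgt ltW// homo.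
by rewrite homo.
Qed.

(** As [nu] is strictly decreasing, its largest value below [nu c] is [nu c.+1]; every loss increase
    therefore advances the index by exactly one. *)
Lemma gammaE n : (1 <= n)%N -> gamma n = nu (stage loss_increase n).
Proof using nu_dec nu_gt0 gamma1 adapt.
elim: n => // -[|n] IH _; first by rewrite /= gamma1.
have gn := IH isT; set c := stage loss_increase n.+1 in gn.
have c1 : (1 <= c)%N by exact: stage_gt0.
have [keep drop] := adapt (isT : (1 <= n.+1)%N).
rewrite [stage _ n.+2]/= -/(stage loss_increase n.+1) -/c /loss_increase.
case: ltP => [lt|le]; last by rewrite addn0 -gn; exact: keep.
have [_ gdec [k k1 gk] gmax] := drop lt.
rewrite addn1 gk; congr nu.
rewrite gk gn nu_mono// in gdec.
(* Strict decrease gave [c < k]; maximality tested at [nu c.+1] gives [k <= c.+1]. *)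
have := gmax c.+1 isT (nu_gt0 (isT : 1 <= c.+1)%N).
rewrite gn nu_mono// => /(_ (ltnSn _)); rewrite gk leNgt nu_mono// => kc.
by apply/eqP; rewrite eqn_leq gdec leqNgt kc.
Qed.

Lemma nu_le m n : (1 <= m)%N -> (m <= n)%N -> nu n <= nu m.
Proof using nu_dec. by move=> m1 mn; rewrite leNgt nu_mono ?inE ?(leq_trans m1)// -leqNgt. Qed.

Lemma gamma_noninc m n : (1 <= m)%N -> (m <= n)%N -> gamma n <= gamma m.
Proof using nu_dec nu_gt0 gamma1 adapt.
move=> m1 mn; rewrite !gammaE//; last exact: leq_trans mn.
by apply: nu_le; [exact: stage_gt0|exact: stage_nondecreasing].
Qed.

(** The index advances by at most one per step. This transfers the divergence of the sum of [nu] to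
    [gamma] and bounds [Nt] by a deterministic index. *)
Lemma gamma_ge_nu n : (1 <= n)%N -> nu n <= gamma n.
Proof using nu_dec nu_gt0 gamma1 adapt.
by move=> n1; rewrite gammaE//; apply: nu_le; [exact: stage_gt0|exact: leq_stage].
Qed.

Lemma batch_mean_near n i z (eta : R) :
  (forall m, (1 <= m <= M)%N -> `|x (n%:Z, m%:Z) ord0 i - z| <= eta) ->
  `|batch_mean x n i - z| <= eta.
Proof.
move=> near_z.
have M0' : 0 < M%:R :> R by rewrite ltr0n.
have -> : batch_mean x n i - z = (\sum_(1 <= m < M.+1) (x (n%:Z, m%:Z) ord0 i - z)) / M%:R.
  rewrite sumrB sumr_const_nat subn1/= /batch_mean -mulr_natr; field.
  by rewrite gt_eqF.
rewrite normrM normfV (gtr0_norm M0') ler_pdivrMr//.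
apply: le_trans (ler_norm_sum _ _ _) _.
apply: (@le_trans _ _ (\sum_(1 <= m < M.+1) eta)).
  by apply: ler_sum_nat => m /andP[m1 mM]; apply: near_z; rewrite m1.
by rewrite sumr_const_nat subn1/= mulr_natr.
Qed.

(** The deviation from [z] is multiplied by [1 - a] with [a = 2 * kappa * g], and [a] times the
    deviation of the batch mean is added; [a < 2] explains the factor in front of [eta]. *)
Lemma sgd_step_near (n : nat) (i : 'I_d) (z eta g : R) :
  0 < g < kappa^-1 -> gamma n.+1 = g ->
  (forall m, (1 <= m <= M)%N -> `|x (n.+1%:Z, m%:Z) ord0 i - z| <= eta) ->
  `|th n.+1 ord0 i - z| <= `|1 - 2 * kappa * g| * `|th n ord0 i - z| + 2 * eta.
Proof.
move=> gk gn near_z; rewrite sgd_coord gn.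
have g0 : 0 < g by case/andP: gk.
have := batch_mean_near near_z; set y := batch_mean _ _ _ => yz.
have -> : th n ord0 i - 2 * kappa * g * (th n ord0 i - y) - z =
  (1 - 2 * kappa * g) * (th n ord0 i - z) + 2 * kappa * g * (y - z) by ring.
have kg := mulr_lt1_of_lt_inv kappa0 gk.
apply: le_trans (ler_normD _ _) _; rewrite !normrM lerD2l.
rewrite (ger0_norm (ltW kappa0)) (ger0_norm (ltW g0)) ger0_norm//.
have := normr_ge0 (y - z); nra.
Qed.

(* With a constant step g, K batches near x0 contract theta to x0; then a batch near x0 + rho e
   pushes theta away from evaluation points near x0 - rho e. *)
Lemma pattern_forces_increase (n0 K : nat) (x0 : 'rV[R]_d) (i0 : 'I_d) (rho r g : R) :
  let q := `|1 - 2 * kappa * g| in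
  let eta := rho / (8 * d%:R) in
  let eta' := eta * (1 - q) / 4 in
  0 < rho -> 0 < g < kappa^-1 -> q ^+ K * r <= eta / 2 ->
  (forall n, (n0 < n <= n0 + K.+1)%N -> gamma n = g) ->
  (forall i, `|th n0 ord0 i - x0 ord0 i| <= r) ->
  (forall k m i, (k < K)%N -> (1 <= m <= M)%N ->
     `|x ((n0 + k).+1%:Z, m%:Z) ord0 i - x0 ord0 i| <= eta') ->
  (forall m i, (1 <= m <= M)%N ->
     `|x ((n0 + K).+1%:Z, m%:Z) ord0 i - (x0 ord0 i + rho * (i == i0)%:R)| <= eta') ->
  (forall m i, (1 <= m <= Mf)%N ->
     `|x ((n0 + K).+1%:Z, - m%:Z) ord0 i - (x0 ord0 i - rho * (i == i0)%:R)| <= eta') ->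
  loss_increase (n0 + K).+1.
Proof.
move=> q eta eta' rho0 gk qK geq th0 pat_center pat_batch pat_eval.
have kg := mulr_lt1_of_lt_inv kappa0 gk.
have q1 : 0 <= q < 1.
  by rewrite normr_ge0/= /q ltr_norml; apply/andP; split; lra.
have d1 : 1 <= d%:R :> R by rewrite ler1n (leq_trans _ (ltn_ord i0)).
have etaE : eta * d%:R = rho / 8 by rewrite /eta; field; lra.
have eta0 : 0 < eta by rewrite divr_gt0//; lra.
have eta'0 : 0 <= eta' by rewrite /eta'; nra.
have eta'E : eta' <= eta / 4 by rewrite /eta'; nra.
have eta_rho : eta <= rho / 8 by nra.
(* [eta'] is chosen so that the stationary error [2 * eta' / (1 - q)] equals [eta / 2]; the decayed
   initial error [q ^+ K * r] uses the other half. *)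
have thK i : `|th (n0 + K)%N ord0 i - x0 ord0 i| <= eta.
  have := @linear_recursion_le _ q (2 * eta') (fun k => `|th (n0 + k)%N ord0 i - x0 ord0 i|) K q1.
  have -> : 2 * eta' / (1 - q) = eta / 2 by rewrite /eta'; field; lra.
  rewrite addn0 => /(_ _ _)/le_trans; apply.
  - lra.
  - move=> k kK; rewrite addnS; apply: sgd_step_near => //.
      by apply: geq; rewrite ltnS leq_addr addnS ltnS leq_add2l ltnW.
    by move=> m mM; exact: pat_center.
  - have := ler_wpM2l (exprn_ge0 K (andP q1).1) (th0 i); lra.
have gN : gamma (n0 + K).+1 = g by apply: geq; rewrite ltnS leq_addr addnS leqnn.
have step_pos (y : 'rV[R]_d) :
    (forall i, `|y ord0 i - (x0 ord0 i - rho * (i == i0)%:R)| <= eta') ->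
    l (th (n0 + K)%N) y < l (th (n0 + K).+1) y.
  move=> y_near; rewrite !lE ltr_pM2l// -subr_gt0 !enorm_sqr -sumrB.
  (* A move by [2 * kappa * g * delta] changes the squared distance to [y] by a cross term plus a
     square, so a positive cross term suffices. *)
  pose delta i := batch_mean x (n0 + K).+1 i - th (n0 + K)%N ord0 i.
  apply: (@lt_le_trans _ _ (4 * (kappa * g) * \sum_(i < d) (delta i * (th (n0 + K)%N ord0 i - y ord0 i)))).
    rewrite mulr_gt0//; first by lra.
    (* In coordinate [i0] both factors are close to [rho]; in the others both are at most [2 * eta]
       in absolute value. The divisor [8 * d] in [eta] makes the total error
       [4 * d * eta ^+ 2 = eta * rho / 2], less than [(rho / 2) ^+ 2]. *)
    apply: (@lt_le_trans _ _ (\sum_(i < d) ((i == i0)%:R * (rho / 2) ^+ 2 - 4 * eta ^+ 2))).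
      rewrite sumrB (bigD1 i0)//= big1 => [|i /negPf ->]; last by rewrite mul0r.
      rewrite eqxx mul1r addr0 sumr_const card_ord -mulr_natr.
      nra.
    apply: ler_sum => i _.
    have := batch_mean_near (fun m mM => pat_batch m i mM); have := y_near i; have := thK i.
    rewrite /delta; set b := batch_mean _ _ _; set t := th _ _ _; set yi := y _ _; set z := x0 _ _.
    rewrite !ler_norml; case: eqP => _ /=; rewrite ?mulr1 ?mulr0 ?mul1r ?mul0r => /andP[? ?] /andP[? ?] /andP[? ?].
      nra.
    nra.
  rewrite mulr_sumr; apply: ler_sum => i _.
  rewrite !mxE sgd_coord gN /delta.
  set b := batch_mean _ _ _; set t := th _ _ _; set yi := y _ _.
  have -> : (t - 2 * kappa * g * (t - b) - yi) ^+ 2 - (t - yi) ^+ 2 =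
     4 * (kappa * g) * ((b - t) * (t - yi)) + (2 * (kappa * g) * (b - t)) ^+ 2 by ring.
  by rewrite lerDl sqr_ge0.
rewrite /loss_increase -subr_gt0 -sumrB big_ltn//.
apply: ltr_wpDr.
  rewrite big_nat sumr_ge0// => m mM; rewrite subr_ge0 ltW// step_pos// => i; apply: pat_eval.
  by case/andP: mM => m2 mM; rewrite (ltnW m2).
by rewrite subr_gt0 step_pos// => i; exact: pat_eval.
Qed.

End path.

(** * The stopped Lyapunov function *)

(* Recursions frozen once the accumulated step size reaches t: at any late enough deterministic
   index they equal the original ones at the random index N_t. *)
Section stopped.
Context {R : realType}.
Variables (kappa nu1 t : R) (g : nat -> R).

Fixpoint stopped_time (n : nat) : R :=
  if n is n'.+1 then stopped_time n' + (if stopped_time n' < t then g n else 0) else 0.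

Definition stopped_step (n : nat) : R := if stopped_time n.-1 < t then g n else 0.

Fixpoint stopped_dev (xi : nat -> R) (D0 : R) (n : nat) : R :=
  if n is n'.+1 then
    stopped_dev xi D0 n' - 2 * kappa * stopped_step n * (stopped_dev xi D0 n' - xi n)
  else D0.

(** With [a = 2 * kappa * s], the value of [a * (2 - a) / s] at the largest step [s = nu1], where it
    is smallest. *)
Definition decay_rate := 2 * kappa * (2 - 2 * kappa * nu1).

(** Normalised at [t]: the weight starts at [exp (- decay_rate * t)] and is at least 1 once the
    accumulated step size has reached [t]. *)
Definition stopped_weight (n : nat) : R := expR (decay_rate * (stopped_time n - t)).

Hypothesis kappa0 : 0 < kappa.
Hypothesis nu1k : 0 < nu1 < kappa^-1.
Hypothesis t0 : 0 <= t.
Hypothesis g0 : forall n, (1 <= n)%N -> 0 < g n <= nu1.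

Lemma stopped_timeS n : stopped_time n.+1 = stopped_time n + stopped_step n.+1.
Proof. by []. Qed.

Lemma stopped_step_ge0 n : 0 <= stopped_step n.+1.
Proof.
by rewrite /stopped_step; case: ifP => // _; have /andP[/ltW] := g0 (isT : (1 <= n.+1)%N).
Qed.

Lemma stopped_step_le n : stopped_step n.+1 <= g n.+1.
Proof.
by rewrite /stopped_step; case: ifP => // _; have /andP[/ltW] := g0 (isT : (1 <= n.+1)%N).
Qed.

Lemma stopped_step_le_nu1 n : stopped_step n.+1 <= nu1.
Proof.
apply: le_trans (stopped_step_le n) _.
by have /andP[] := g0 (isT : (1 <= n.+1)%N).
Qed.

Lemma stopped_time_ge0 n : 0 <= stopped_time n.
Proof. by elim: n => // n IH; rewrite stopped_timeS addr_ge0// stopped_step_ge0. Qed.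

Lemma stopped_time_le n : stopped_time n <= t + nu1.
Proof.
have /andP[n0 _] := nu1k.
elim: n => [|n IH /=]; first by rewrite /= addr_ge0// ltW.
case: ltP => [lt|_]; last by rewrite addr0.
by apply: lerD; [exact: ltW|have /andP[] := g0 (isT : (1 <= n.+1)%N)].
Qed.

Lemma stopped_time_le_mul n : stopped_time n <= n%:R * nu1.
Proof.
elim: n => [|n IH]; first by rewrite mul0r.
by rewrite stopped_timeS mulrSr mulrDl mul1r lerD// stopped_step_le_nu1.
Qed.

Let kg : 0 < kappa * nu1 < 1.
Proof. exact: mulr_lt1_of_lt_inv. Qed.

Lemma decay_rate_gt0 : 0 < decay_rate.
Proof.
have := kg; rewrite /decay_rate => /andP[_ kg1].
apply: mulr_gt0; first exact: mulr_gt0.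
by rewrite subr_gt0 -mulrA gtr_pMr.
Qed.

Lemma stopped_weightS n :
  stopped_weight n.+1 = stopped_weight n * expR (decay_rate * stopped_step n.+1).
Proof. by rewrite /stopped_weight -expRD stopped_timeS; congr expR; ring. Qed.

Lemma stopped_weight_gt0 n : 0 < stopped_weight n.
Proof. exact: expR_gt0. Qed.

Lemma stopped_weight_ge n : expR (- (decay_rate * t)) <= stopped_weight n.
Proof.
rewrite ler_expR mulrBr lerBrDl subrr mulr_ge0// ?stopped_time_ge0//.
exact: ltW decay_rate_gt0.
Qed.

Lemma stopped_weight_le n : stopped_weight n <= expR (decay_rate * nu1).
Proof.
rewrite ler_expR ler_pM2l ?decay_rate_gt0//.
by have := stopped_time_le n; lra.
Qed.

(* (1 - a)^2 = 1 - a (2 - a) <= exp (- decay_rate * s) for a = 2 kappa s, as a <= 2 kappa nu1 < 2. *)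
Lemma stopped_weight_contract n :
  stopped_weight n.+1 * (1 - 2 * kappa * stopped_step n.+1) ^+ 2 <= stopped_weight n.
Proof.
rewrite stopped_weightS -mulrA ler_piMr ?(ltW (stopped_weight_gt0 n))//.
have s0 := stopped_step_ge0 n; have s1 := stopped_step_le_nu1 n.
set s := stopped_step n.+1 in s0 s1 *.
rewrite mulrC -ler_pdivlMr ?expR_gt0// mul1r -expRN.
apply: le_trans (expR_ge1Dx _).
have : 0 <= kappa * s * (kappa * (nu1 - s)).
  by rewrite !mulr_ge0 ?subr_ge0// ltW.
rewrite /decay_rate; nra.
Qed.

(** Expansion of the square of [(1 - a) * D + a * xi] with [a = 2 * kappa * s]; the weight
    contraction absorbs the first term and the cross term stays linear in the noise. *)
Lemma stopped_lyapunov xi D0 n s D w :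
  s = stopped_step n.+1 -> D = stopped_dev xi D0 n -> w = stopped_weight n.+1 ->
  w * stopped_dev xi D0 n.+1 ^+ 2 <= stopped_weight n * D ^+ 2
    + w * (2 * (1 - 2 * kappa * s) * (2 * kappa * s)) * D * xi n.+1
    + w * (2 * kappa * s) ^+ 2 * xi n.+1 ^+ 2.
Proof.
move=> sE DE wE; have := ler_wpM2r (sqr_ge0 D) (stopped_weight_contract n).
have -> : stopped_dev xi D0 n.+1 = D - 2 * kappa * s * (D - xi n.+1) by rewrite sE DE.
rewrite -sE -wE; nra.
Qed.

(** A Riemann sum for the integral of [exp (decay_rate * (S - t))] in [S]. Each summand is at most a
    constant times the increment of the weight, so the sum telescopes; one exponential factor pays
    for the right endpoints, the other bounds the final weight. *)
Lemma sum_stopped_weight_step n :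
  \sum_(k < n) stopped_weight k.+1 * stopped_step k.+1 <=
  expR (decay_rate * nu1) ^+ 2 / decay_rate.
Proof.
have c0 := decay_rate_gt0; have E0 := expR_gt0 (decay_rate * nu1).
have telescope m : \sum_(k < m) stopped_weight k.+1 * stopped_step k.+1 <=
    expR (decay_rate * nu1) / decay_rate * stopped_weight m.
  elim: m => [|m IH].
    by rewrite big_ord0 mulr_ge0 ?divr_ge0 ?ltW// stopped_weight_gt0.
  rewrite big_ord_recr/=; apply: le_trans (lerD IH (lexx _)) _.
  have s0 := stopped_step_ge0 m; have s1 := stopped_step_le_nu1 m.
  have w0 := stopped_weight_gt0 m.
  rewrite stopped_weightS; set s := stopped_step m.+1 in s0 s1 *.
  have e1 : 1 + decay_rate * s <= expR (decay_rate * s) by exact: expR_ge1Dx.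
  have e2 : expR (decay_rate * s) <= expR (decay_rate * nu1).
    by rewrite ler_expR ler_pM2l.
  set e := expR (decay_rate * s) in e1 e2 *; set E := expR _ in E0 e2 *.
  set w := stopped_weight m in w0 *.
  rewrite -(ler_pM2r c0) mulrDl [X in X + _](_ : _ = E * w); last by field; rewrite gt_eqF.
  rewrite [leRHS](_ : _ = E * (w * e)); last by field; rewrite gt_eqF.
  have wE0 : 0 <= w * E by apply: mulr_ge0; exact: ltW.
  have ecs : 0 <= e - 1 - decay_rate * s by lra.
  have := mulr_ge0 wE0 ecs.
  have cs0 : 0 <= decay_rate * s by apply: mulr_ge0 => //; exact: ltW.
  have wEe : 0 <= w * (E - e) by apply: mulr_ge0; rewrite ?subr_ge0// ltW.
  have := mulr_ge0 wEe cs0.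
  move: (decay_rate) => c; clear; nra.
apply: le_trans (telescope n) _.
rewrite expr2 mulrAC ler_pM2r ?invr_gt0// ler_pM2l//; exact: stopped_weight_le.
Qed.

(** Among the first [k0] steps the accumulated time is at most [k0 * nu1], which leaves a factor
    [exp (- decay_rate * t)]. Afterwards one factor of the squared step is bounded by [g k0] and the
    Riemann sum remains. *)
Lemma sum_stopped_weight_sqr n k0 : (1 <= k0)%N ->
  {homo g : m n / (k0 <= m <= n)%N >-> n <= m} ->
  \sum_(k < n) stopped_weight k.+1 * (2 * kappa * stopped_step k.+1) ^+ 2 <=
  4 * kappa ^+ 2 * (k0%:R * (nu1 ^+ 2 * expR (decay_rate * (k0%:R * nu1))) * expR (- (decay_rate * t))
    + g k0 * (expR (decay_rate * nu1) ^+ 2 / decay_rate)).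
Proof.
move=> k01 gmono; have /andP[n0 _] := nu1k.
have c0 := decay_rate_gt0.
have -> : \sum_(k < n) stopped_weight k.+1 * (2 * kappa * stopped_step k.+1) ^+ 2 =
    4 * kappa ^+ 2 * \sum_(k < n) stopped_weight k.+1 * stopped_step k.+1 ^+ 2.
  by rewrite mulr_sumr; apply: eq_bigr => k _; ring.
rewrite ler_pM2l ?mulr_gt0 ?exprn_gt0//.
rewrite (bigID (fun k : 'I_n => (k < k0)%N))/= lerD//.
  set E := nu1 ^+ 2 * expR (decay_rate * (k0%:R * nu1)) * expR (- (decay_rate * t)).
  have E0 : 0 <= E by rewrite !mulr_ge0 ?expR_ge0// ltW.
  rewrite -mulrA -[_ * _ * expR _]/E.
  apply: (@le_trans _ _ (\sum_(k < n | (k < k0)%N) E)); last first.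
    rewrite sumr_const -[leLHS]mulr_natl ler_wpM2r// ler_nat -sum1_card big_mkcond/=.
    have : (\sum_(k < n) (k < k0)%N <= minn n k0)%N.
      elim: n => [|n IH]; first by rewrite big_ord0.
      rewrite big_ord_recr/=; apply: leq_trans (leq_add IH (leqnn _)) _.
      by case: (ltnP n k0) => nk /=; lia.
    by move=> /leq_trans; apply; exact: geq_minr.
  apply: ler_sum => k kk0.
  have s0 := stopped_step_ge0 k; have s1 := stopped_step_le_nu1 k.
  rewrite mulrC /E -mulrA -expRD ler_pM ?exprn_ge0 ?expR_ge0//.
    by rewrite ler_pXn2r// nnegrE ltW.
  rewrite ler_expR mulrBr lerD2r ler_pM2l//.
  apply: le_trans (stopped_time_le_mul _) _.
  by rewrite ler_pM2r// ler_nat.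
apply: (@le_trans _ _ (g k0 * \sum_(k < n) stopped_weight k.+1 * stopped_step k.+1)).
  rewrite mulr_sumr [leRHS](bigID (fun k : 'I_n => (k < k0)%N))/= -[leLHS]add0r lerD//.
    apply: sumr_ge0 => k _; have /andP[/ltW g0' _] := g0 k01.
    by rewrite !mulr_ge0// ?stopped_step_ge0// ltW// stopped_weight_gt0.
  apply: ler_sum => k; rewrite -leqNgt => k0k.
  rewrite expr2 mulrA mulrC ler_wpM2r//.
    by rewrite mulr_ge0 ?stopped_step_ge0// ltW// stopped_weight_gt0.
  by apply: le_trans (stopped_step_le k) _; apply: gmono; rewrite leqnn leqW.
by rewrite ler_wpM2l ?sum_stopped_weight_step//; have /andP[/ltW] := g0 k01.
Qed.


(** Up to [N] every step is taken unchanged; from [N] on every stopped step is 0, so nothing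
    moves. *)
Lemma stopped_dev_first_hit xi D0 (D : nat -> R) N n :
  D 0%N = D0 ->
  (forall m, D m.+1 = D m - 2 * kappa * g m.+1 * (D m - xi m.+1)) ->
  (forall m, (m < N)%N -> \sum_(1 <= k < m.+1) g k < t) ->
  t <= \sum_(1 <= k < N.+1) g k -> (N <= n)%N ->
  stopped_dev xi D0 n = D N /\ t <= stopped_time n.
Proof.
move=> D0E DS before after.
have upto m : (m <= N)%N -> stopped_dev xi D0 m = D m /\ stopped_time m = \sum_(1 <= k < m.+1) g k.
  elim: m => [_|m IH mN]; first by rewrite big_geq.
  have [Dm Sm] := IH (ltnW mN).
  have lt : stopped_time m < t by rewrite Sm; exact: before.
  by rewrite /= /stopped_step /= lt Dm DS big_nat_recr//= Sm.
elim: n => [|n IH]; first by rewrite leqn0 => /eqP N0; subst N; have [-> ->] := upto 0%N isT.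
rewrite leq_eqVlt => /orP[/eqP <-|]; first by have [-> ->] := upto N (leqnn N).
rewrite ltnS => /IH[Dn tn].
have nlt : (stopped_time n < t) = false by rewrite ltNge tn.
by rewrite /= /stopped_step /= nlt addr0 mulr0 mul0r subr0.
Qed.

End stopped.

(** * Almost sure and mean estimates *)

Section adaptive_sgd.
Context {dT : measure_display} {T : measurableType dT} {R : realType}.
Variables (P : probability T R) (d : nat) (X : int * int -> T -> 'rV[R]_d).
Variables (kappa : R) (l : 'rV[R]_d -> 'rV[R]_d -> R) (M Mf : nat).
Variables (Theta : nat -> T -> 'rV[R]_d) (gamma : nat -> T -> R) (nu : nat -> R).

Let xs w j := X j w.
Let ths w n := Theta n w.
Let gs w n := gamma n w.
Let inc w := loss_increase Mf l (ths w) (xs w).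

Hypothesis d0 : (0 < d)%N.
Hypothesis kappa0 : 0 < kappa.
Hypothesis mX : forall j, rvRd (X j).
Hypothesis ndX : nondegenerate_rv P (X (1%:Z, 1%:Z)).
Hypothesis idX : forall j, ident_distr P (X j) (X (1%:Z, 1%:Z)).
Hypothesis indX : mutually_independent P (fun j => sigma_of (X j)).
Hypothesis lE : forall th x, l th x = kappa * (enorm (th - x)) ^+ 2.
Hypothesis M0 : (0 < M)%N.
Hypothesis Mf0 : (0 < Mf)%N.
Hypothesis mTheta : forall n, rvRd (Theta n).
Hypothesis mgamma : forall n, (1 <= n)%N -> measurable_fun setT (gamma n).
Hypothesis sgd : forall n w, Theta n.+1 w = Theta n w - (gamma n.+1 w / M%:R) *:
  \sum_(1 <= m < M.+1) grad (fun th => l th (X (n.+1%:Z, m%:Z) w)) (Theta n w).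
Hypothesis nu_dec : forall n, (1 <= n)%N -> nu n.+1 < nu n.
Hypothesis nu_gt0 : forall n, (1 <= n)%N -> 0 < nu n.
Hypothesis nu_small : forall e, 0 < e -> exists2 n, (1 <= n)%N & nu n < e.
Hypothesis nu1 : nu 1%N < kappa^-1.
Hypothesis gamma1 : forall w, gamma 1%N w = nu 1%N.
Hypothesis adapt : forall n w, (1 <= n)%N ->
  let Lnew := \sum_(1 <= m < Mf.+1) l (Theta n w) (X (n%:Z, - m%:Z) w) in
  let Lold := \sum_(1 <= m < Mf.+1) l (Theta n.-1 w) (X (n%:Z, - m%:Z) w) in
  (Lnew <= Lold -> gamma n.+1 w = gamma n w) /\
  (Lold < Lnew ->
     [/\ 0 < gamma n.+1 w, gamma n.+1 w < gamma n w,
         (exists2 k, (1 <= k)%N & gamma n.+1 w = nu k) &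
         (forall k, (1 <= k)%N -> 0 < nu k -> nu k < gamma n w -> nu k <= gamma n.+1 w)]).
Hypothesis indTheta : independent2 P <<s \bigcup_j sigma_of (X j) >> (sigma_of (Theta 0%N)).

Let gE w n : (1 <= n)%N -> gamma n w = nu (stage (inc w) n).
Proof.
move=> n1; apply: (gammaE (gamma := gs w) (th := ths w) (x := xs w) nu_dec nu_gt0 (gamma1 w) _ n1) => m m1.
exact: adapt m1.
Qed.

(* The factor s selects the points x0, x0 + rho e and x0 - rho e of the support. *)
Lemma support_pattern : exists (x0 : 'rV[R]_d) (i0 : 'I_d) (rho : R), 0 < rho /\
  forall s r : R, s \in [:: 0; 1; -1] -> 0 < r ->
    (0 < P (X (1%:Z, 1%:Z) @^-1` ball (x0 + (s * rho) *: delta_mx 0 i0)%R r))%E.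
Proof.
have [x0 /nbhs_ballP[e /= e0 xe]] := ndX.
have i0 : 'I_d by exact: (Ordinal d0).
exists x0, i0, (e / 2); split; first by rewrite divr_gt0.
move=> s r s01 r0; set z := x0 + _.
have s1 : `|s| <= 1.
  by move: s01; rewrite !inE => /or3P[] /eqP->; rewrite ?normr0 ?normrN ?normr1.
(* Balls of row vectors are taken in the sup norm, and the shift has size at most [e / 2]. *)
have /xe supz : ball x0 e z.
  split=> // i j; rewrite /ball/= /z !mxE opprD addrA subrr sub0r normrN.
  apply: (@le_lt_trans _ _ (e / 2)); last by lra.
  rewrite normrM normrM (ger0_norm (_ : 0 <= e / 2)); last by lra.
  rewrite -[leRHS]mulr1 ler_pM ?mulr_ge0 ?normr_ge0//; try by lra.
    by rewrite -[leRHS]mul1r ler_wpM2r//; lra.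
  by case: (_ && _); rewrite ?normr1 ?normr0.
apply: lt_le_trans (supz (ball z r)^° _ _) _.
- exact: open_interior.
- by apply: nbhsx_ballx.
- apply: le_measure; rewrite ?inE.
  + by apply: mX; apply: borelRd_open; exact: open_interior.
  + apply: mX; apply: borelRd_open; exact: ball_open.
  + by apply: preimage_subset; exact: interior_subset.
Qed.


Let step_range k : (1 <= k)%N -> 0 < nu k < kappa^-1.
Proof.
by move=> k1; rewrite nu_gt0//= (le_lt_trans _ nu1)// nu_le.
Qed.

Let ratio_range k : (1 <= k)%N -> 0 <= `|1 - 2 * kappa * nu k| < 1.
Proof.
move=> /step_range/(mulr_lt1_of_lt_inv kappa0) kg.
by rewrite normr_ge0/= ltr_norml; apply/andP; split; lra.
Qed.

(** Induction on the stage along one path: a stage reached but never left would mean a constant step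
    and bounded iterates, and then a pattern block would force an increase. *)
Lemma stage_unbounded :
  (exists C : R, {ae P, forall w, forall j i, `|X j w ord0 i| <= C}) ->
  {ae P, forall w, forall k, exists n, (k <= stage (inc w) n)%N}.
Proof.
move=> [C bndX]; have [x0 [i0 [rho [rho0 pos]]]] := support_pattern.
pose q k : R := `|1 - 2 * kappa * nu k|.
pose eta := rho / (8 * d%:R).
have eta0 : 0 < eta by rewrite divr_gt0// mulr_gt0// ltr0n.
pose eta' k := eta * (1 - q k) / 4.
(* Rows before [K] lie near [x0]; in row [K] the gradient batch lies near [x0 + rho e] and the
   evaluation points near [x0 - rho e]. *)
pose V k K i (m : int) : set 'rV[R]_d := ball (x0 + ((if (i < K)%N then 0 else
    if (0 < m) then 1 else -1) * rho) *: delta_mx 0 i0) (eta' k).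
(* The radius needed depends on the path. Quantifying over natural [k] and [r] keeps a single null
   set, and [K] depends on [k] and [r] only. *)
have patterns : {ae P, forall w k r, (1 <= k)%N -> exists2 K,
    q k ^+ K * r%:R <= eta / 2 &
    forall n, exists2 j, (n <= j)%N & forall i m, (i < K.+1)%N ->
      - (M + Mf)%:Z <= m <= (M + Mf)%:Z -> V k K i m (X ((j * K.+1 + i).+1%:Z, m) w)}.
  apply/ae_foralln => k; apply/ae_foralln => r.
  have [k1|k0] := boolP (1 <= k)%N; last by apply: aeW => w.
  have /andP[q0 q1] := ratio_range k1.
  have [K HK] : exists K, q k ^+ K * r%:R <= eta / 2.
    have : q k ^+ n * r%:R @[n --> \oo] --> 0.
      rewrite -(mul0r r%:R); apply: cvgMl; apply: cvg_expr.
      by rewrite ger0_norm.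
    move=> /cvgr0_norm_le/(_ (eta / 2))[]; first by rewrite divr_gt0.
    move=> N _ /(_ N (leqnn N)) b; exists N; apply: le_trans b.
    exact: ler_norm.
  have eta'0 : 0 < eta' k by rewrite /eta' divr_gt0// mulr_gt0// subr_gt0.
  have mV i m : borelRd (V k K i m) by apply: borelRd_open; exact: ball_open.
  have posV i m : (0 < P (X (1%:Z, 1%:Z) @^-1` V k K i m))%E.
    by apply: pos => //; case: ifP => _; [|case: ifP => _]; rewrite !inE eqxx ?orbT.
  have := block_pattern_infinitely_often mX (mTheta 0) idX indX indTheta K.+1 (M + Mf) mV posV.
  by apply: filterS => w io _; exists K.
apply: filterS2 bndX patterns => w Cw pat.
elim=> [|k [n0 IH]]; first by exists 0%N.
apply: contrapT => bounded.
(* If stage [k.+1] is never reached, the stage is [k] after [n0]. Starting at [n0.+1] keeps the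
   index positive, as [gE] requires. *)
have le_k n : (stage (inc w) n <= k)%N.
  by rewrite leqNgt; apply/negP => kn; apply: bounded; exists n.
have eq_k n : (n0.+1 <= n)%N -> stage (inc w) n = k.
  move=> n0n; apply/eqP; rewrite eqn_leq le_k (leq_trans IH)// stage_nondecreasing//.
  exact: ltnW.
have k1 : (1 <= k)%N by rewrite -(eq_k n0.+1)// stage_gt0.
have gk n : (n0.+1 <= n)%N -> gamma n w = nu k.
  by move=> n0n; rewrite gE ?eq_k//; exact: leq_trans n0n.
have qk := ratio_range k1; have /andP[q0 q1] := qk.
(* The bound of [linear_recursion_le] for samples bounded by [C]; [r] then rounds the sum over
   coordinates up to an integer. *)
pose far i := `|Theta n0.+1 w ord0 i - x0 ord0 i| + 2 * (C + `|x0 ord0 i|) / (1 - q k).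
have C0 : 0 <= C by apply: le_trans (Cw (0, 0) i0); exact: normr_ge0.
have far0 i : 0 <= far i.
  by rewrite addr_ge0// divr_ge0// ?subr_ge0 ?(ltW q1)// mulr_ge0// addr_ge0.
pose r := (Num.truncn (\sum_i far i)).+1.
have near_r n i : (n0.+1 <= n)%N -> `|Theta n w ord0 i - x0 ord0 i| <= r%:R.
  move=> n0n; rewrite -(subnKC n0n).
  apply: (@le_trans _ _ (far i)); last first.
    apply: ltW; apply: le_lt_trans (truncnS_gt _).
    by rewrite (bigD1 i)//= lerDl sumr_ge0.
  have := @linear_recursion_le _ (q k) (2 * (C + `|x0 ord0 i|))
    (fun n => `|Theta (n0.+1 + n)%N w ord0 i - x0 ord0 i|) (n - n0.+1) qk.
  rewrite addn0 => /(_ _ _)/le_trans; apply.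
  - by rewrite mulr_ge0// addr_ge0.
  - move=> m _; rewrite addnS.
    apply: (sgd_step_near (th := ths w) (x := xs w) (gamma := gs w) kappa0 M0 lE) => //.
    + by move=> p; exact: sgd.
    + exact: step_range.
    + by apply: gk; rewrite -addnS leq_addr.
    + by move=> m' _; apply: le_trans (ler_normB _ _) _; rewrite lerD2r; exact: Cw.
  - rewrite lerD2r ler_piMl// exprn_ile1//; exact: ltW.
have [K qK io] := pat k r k1; have [j n0j Vj] := io n0.+1.
have jK : (n0.+1 <= j * K.+1)%N by apply: leq_trans n0j _; exact: leq_pmulr.
have near_coord i m s c : V k K i m (X ((j * K.+1 + i).+1%:Z, m) w) ->
    s = (if (i < K)%N then 0 else if (0 < m) then 1 else -1) ->
    `|X ((j * K.+1 + i).+1%:Z, m) w ord0 c - (x0 ord0 c + s * rho * (c == i0)%:R)| <= eta' k.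
  move=> + -> => -[_ /(_ ord0 c)]; rewrite /ball/= !mxE eqxx/= distrC => /ltW.
  by [].
suff incN : inc w (j * K.+1 + K).+1.
  have jKK : (n0.+1 <= (j * K.+1 + K).+1)%N by rewrite (leq_trans jK)// -addnS leq_addr.
  have := eq_k (j * K.+1 + K).+2 (leqW jKK).
  by rewrite stageS incN eq_k//= addn1 => /eqP; rewrite -[X in _ == X]addn0 -addn1 eqn_add2l.
apply: (@pattern_forces_increase _ _ M Mf kappa l (ths w) (xs w) (gs w) kappa0 M0 Mf0 lE
  _ (j * K.+1) K x0 i0 rho r%:R (nu k)) => //.
- by move=> n; exact: sgd.
- exact: step_range.
- by move=> n /andP[jn _]; apply: gk; exact: leq_trans jK (ltnW jn).
- by move=> i; exact: near_r.
- move=> i m c iK mM; have := near_coord i m%:Z 0 c; rewrite iK !mul0r addr0; apply => //.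
  by apply: Vj; [exact: ltnW|lia].
- move=> m c mM; have := near_coord K m%:Z 1 c; rewrite ltnn mul1r.
  have -> : (0 < m%:Z) by lia.
  by apply => //; apply: Vj => //; lia.
- move=> m c mM; have := near_coord K (- m%:Z) (-1) c; rewrite ltnn mulN1r mulNr.
  have -> : (0 < - m%:Z) = false by lia.
  by apply => //; apply: Vj => //; lia.
Qed.

(** * Measurability of the scheme with respect to the past *)

Let B := (M + Mf)%N.
(** The sample space with the sigma-algebra of the past up to time [N]; [B] is large enough to cover
    gradient and evaluation samples. *)
Let filtration N := g_sigma_algebraType (past X (Theta 0%N) (block B 0 N)).

Let measurable_X N n m i : (0 < n <= N)%N -> - B%:Z <= m <= B%:Z ->
  measurable_fun setT (fun w : filtration N => X (n%:Z, m) w ord0 i).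
Proof. by move=> nN mB; apply: past_measurable_coord; rewrite mem_block nN. Qed.

Let measurable_batch_mean N n i : (0 < n <= N)%N ->
  measurable_fun setT (fun w : filtration N => batch_mean M (xs w) n i).
Proof.
move=> nN; rewrite /batch_mean /=; apply: measurable_funM => //.
(* [measurable_sum] asks for measurability at every natural [m], so the summand is set to 0 outside
   the range of the sum. *)
rewrite (_ : (fun w => _) = (fun w : filtration N =>
  \sum_(m <- index_iota 1 M.+1) (if (m <= M)%N then X (n%:Z, m%:Z) w ord0 i else 0))); last first.
  apply/funext => w; apply: eq_big_seq => m; rewrite mem_index_iota ltnS => /andP[_ ->].
  by [].
apply: measurable_sum => m; case: leqP => mM //; apply: measurable_X => //; rewrite /B; lia.
Qed.

Let measurable_loss N n k m : (0 < n <= N)%N -> - B%:Z <= m <= B%:Z ->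
  (forall i, measurable_fun setT (fun w : filtration N => Theta k w ord0 i)) ->
  measurable_fun setT (fun w : filtration N => l (Theta k w) (X (n%:Z, m) w)).
Proof.
move=> nN mB mTh.
rewrite (_ : (fun w => _) = (fun w : filtration N =>
  kappa * \sum_(i < d) (Theta k w ord0 i - X (n%:Z, m) w ord0 i) ^+ 2)); last first.
  apply/funext => w; rewrite lE enorm_sqr; congr (_ * _).
  by apply: eq_bigr => i _; rewrite !mxE.
apply: measurable_funM => //; apply: measurable_sum => i.
apply: measurable_funX; apply: measurable_funB => //; exact: measurable_X.
Qed.

Let measurable_loss_sum N n k : (0 < n <= N)%N ->
  (forall i, measurable_fun setT (fun w : filtration N => Theta k w ord0 i)) ->
  measurable_fun setT (fun w : filtration N =>
    \sum_(1 <= m < Mf.+1) l (Theta k w) (X (n%:Z, - m%:Z) w)).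
Proof.
move=> nN mTh.
rewrite (_ : (fun w => _) = (fun w : filtration N => \sum_(m <- index_iota 1 Mf.+1)
  (if (m <= Mf)%N then l (Theta k w) (X (n%:Z, - m%:Z) w) else 0))); last first.
  apply/funext => w; apply: eq_big_seq => m; rewrite mem_index_iota ltnS => /andP[_ ->].
  by [].
apply: measurable_sum => m; case: leqP => mM //; apply: measurable_loss => //; rewrite /B; lia.
Qed.

Let Theta_coord w n i : Theta n.+1 w ord0 i = Theta n w ord0 i -
  2 * kappa * gamma n.+1 w * (Theta n w ord0 i - batch_mean M (xs w) n.+1 i).
Proof.
by apply: (sgd_coord (th := ths w) (gamma := gs w) M0 lE) => m; exact: sgd.
Qed.

(** A joint induction: the evaluation at time [n] already decides the stage of step [n.+1], so the
    step size is predictable. *)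
Lemma past_measurable_state N n : (n <= N)%N ->
  (forall i, measurable_fun setT (fun w : filtration N => Theta n w ord0 i)) /\
  measurable_fun setT (fun w : filtration N => stage (inc w) n.+1).
Proof.
elim/ltn_ind: n => -[|n] IH nN.
  by split => [i|]; [exact: past_measurable_initial|exact: (measurable_cst 1%N)].
have [mTh mst] := IH n (ltnSn n) (ltnW nN).
have mTh' i : measurable_fun setT (fun w : filtration N => Theta n.+1 w ord0 i).
  rewrite (_ : (fun w => _) = (fun w : filtration N => Theta n w ord0 i -
    2 * kappa * nu (stage (inc w) n.+1) * (Theta n w ord0 i - batch_mean M (xs w) n.+1 i))); last first.
    by apply/funext => w; rewrite Theta_coord gE.
  apply: measurable_funB => //; apply: measurable_funM; last first.
    by apply: measurable_funB => //; exact: measurable_batch_mean.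
  apply: measurable_funM => //.
  by apply: (@measurableT_comp _ _ _ _ _ _ nu).
split => //.
rewrite (_ : (fun w => _) = (fun w : filtration N =>
  if inc w n.+1 then (stage (inc w) n.+1).+1 else stage (inc w) n.+1)); last first.
  by apply/funext => w; rewrite stageS /=; case: (inc w n.+1); rewrite ?addn1 ?addn0.
apply: measurable_fun_ifT => //.
  by apply: measurable_fun_ltr; apply: measurable_loss_sum.
by apply: (@measurableT_comp _ _ _ _ _ _ S).
Qed.

Lemma past_measurable_gamma N n : (0 < n <= N.+1)%N ->
  measurable_fun setT (fun w : filtration N => gamma n w).
Proof.
case: n => // n /andP[_ nN]; have [_ mst] := past_measurable_state (nN : (n <= N)%N).
rewrite (_ : (fun w => _) = (fun w : filtration N => nu (stage (inc w) n.+1))); last first.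
  by apply/funext => w; rewrite gE.
by apply: (@measurableT_comp _ _ _ _ _ _ nu).
Qed.

(** * The stopped Lyapunov process of one coordinate *)

Section stopped_processes.
Variables (t : R) (i : 'I_d).
Hypothesis t0 : 0 <= t.

Let mean := fine (\int[P]_w (X (1%:Z, 1%:Z) w ord0 i)%:E)%E.
Let noise w n := batch_mean M (xs w) n i - mean.
Let S w n := stopped_time t (gs w) n.
Let s w n := stopped_step t (gs w) n.
Let D w n := stopped_dev kappa t (gs w) (noise w) (Theta 0%N w ord0 i - mean) n.
Let W w n := stopped_weight kappa (nu 1%N) t (gs w) n.

Lemma past_measurable_stopped_time N n : (n <= N.+1)%N ->
  measurable_fun setT (fun w : filtration N => S w n).
Proof.
elim: n => [|n IH] nN; first exact: measurable_cst.
apply: measurable_funD; first exact: IH (ltnW nN).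
apply: measurable_fun_ifT => //.
  by apply: measurable_fun_ltr => //; exact: IH (ltnW nN).
exact: past_measurable_gamma.
Qed.

Lemma past_measurable_stopped_step N n : (n <= N)%N ->
  measurable_fun setT (fun w : filtration N => s w n.+1).
Proof.
move=> nN; apply: measurable_fun_ifT => //.
  apply: measurable_fun_ltr => //; apply: past_measurable_stopped_time; exact: leqW.
exact: past_measurable_gamma.
Qed.

Lemma past_measurable_stopped_weight N n : (n <= N.+1)%N ->
  measurable_fun setT (fun w : filtration N => W w n).
Proof.
move=> nN; apply: (@measurableT_comp _ _ _ _ _ _ (@expR R)) => //.
apply: measurable_funM => //; apply: measurable_funB => //.
exact: past_measurable_stopped_time.
Qed.

Lemma past_measurable_stopped_dev N n : (n <= N)%N ->
  measurable_fun setT (fun w : filtration N => D w n).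
Proof.
elim: n => [|n IH] nN.
  by apply: measurable_funB => //; exact: past_measurable_initial.
have mD := IH (ltnW nN).
apply: measurable_funB => //; apply: measurable_funM.
  apply: measurable_funM => //; apply: past_measurable_stopped_step; exact: ltnW.
apply: measurable_funB => //; apply: measurable_funB => //.
exact: measurable_batch_mean.
Qed.


Variable C : R.
Hypothesis bndX : {ae P, forall w, forall j i, `|X j w ord0 i| <= C}.
Hypothesis iTheta : P.-integrable setT (EFin \o (fun w => (Theta 0%N w ord0 i - mean) ^+ 2)).

Let Xc j w := X j w ord0 i - mean.
Let var := \int[P]_w Xc (1%:Z, 1%:Z) w ^+ 2.
Let E := expR (decay_rate kappa (nu 1%N) * nu 1%N).
(** [U] is the Lyapunov process; [Q] and [Z] are the coefficients of the squared noise and of the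
    noise in [stopped_lyapunov]. By predictability of the step both are known at time [n], although
    they carry index [n.+1]. *)
Let U n w := W w n * D w n ^+ 2.
Let Q n w := W w n.+1 * (2 * kappa * s w n.+1) ^+ 2.
Let Z n w := W w n.+1 * (2 * (1 - 2 * kappa * s w n.+1) * (2 * kappa * s w n.+1)) * D w n.

Let mXc j : measurable_fun setT (Xc j).
Proof. by apply: measurable_funB => //; exact: rvRd_coord. Qed.

Let bndXc : {ae P, forall w, forall j, `|Xc j w| <= C + `|mean|}.
Proof.
apply: filterS bndX => w Cw j; apply: le_trans (ler_normB _ _) _.
by rewrite lerD2r.
Qed.

Let iXc j : P.-integrable setT (EFin \o Xc j).
Proof.
by apply: (@integrable_ae_bounded _ _ _ P _ (C + `|mean|)) => //; apply: filterS bndXc => w; apply.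
Qed.

Let iXc2 j : P.-integrable setT (EFin \o (fun w => Xc j w ^+ 2)).
Proof.
apply: (@integrable_ae_bounded _ _ _ P _ ((C + `|mean|) ^+ 2)).
  exact: measurable_funX.
apply: filterS bndXc => w /(_ j) le; rewrite normrX lerXn2r ?nnegrE//.
exact: le_trans le.
Qed.

Let iX j : P.-integrable setT (EFin \o (fun w => X j w ord0 i)).
Proof.
apply: (@integrable_ae_bounded _ _ _ P _ C); first exact: rvRd_coord.
by apply: filterS bndX => w /(_ j i).
Qed.

Let EXc j : \int[P]_w Xc j w = 0.
Proof.
rewrite (@Rintegral_ident_distr _ _ _ P d X mX idX j i (fun y => y - mean))//.
  rewrite RintegralB//; last exact: integrable_EFin_cst.
  by rewrite Rintegral_EFin_cst subrr.
by apply: measurable_funB.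
Qed.

Let EXc2 j : \int[P]_w Xc j w ^+ 2 = var.
Proof.
rewrite (@Rintegral_ident_distr _ _ _ P d X mX idX j i (fun y => (y - mean) ^+ 2))//.
by apply: measurable_funX; exact: measurable_funB.
Qed.

Let var0 : 0 <= var.
Proof. by apply: Rintegral_ge0 => w _; exact: sqr_ge0. Qed.

Let nu1k : 0 < nu 1%N < kappa^-1.
Proof. exact: step_range. Qed.

Let gs_range w n : (1 <= n)%N -> 0 < gs w n <= nu 1%N.
Proof.
move=> n1; rewrite /gs gE// nu_gt0 ?stage_gt0//=.
by apply: nu_le => //; exact: stage_gt0.
Qed.

Let s_range w n : 0 <= 2 * kappa * s w n.+1 <= 2.
Proof.
have s0 : 0 <= s w n.+1 := stopped_step_ge0 t (gs_range w) n.
have s1 : s w n.+1 <= nu 1%N := stopped_step_le_nu1 t (gs_range w) n.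
have /andP[_ kg] := mulr_lt1_of_lt_inv kappa0 nu1k.
have ks : kappa * s w n.+1 <= kappa * nu 1%N by rewrite ler_pM2l.
rewrite -mulrA mulr_ge0 ?mulr_ge0 ?(ltW kappa0)//=.
by rewrite -[leRHS]mulr1 ler_pM2l// ltW// (le_lt_trans ks).
Qed.

Let W0 w n : 0 <= W w n. Proof. exact/ltW/stopped_weight_gt0. Qed.

Let W_le w n : W w n <= E.
Proof. exact: (stopped_weight_le kappa0 nu1k t0 (gs_range w)). Qed.

Let noiseE w n : noise w n.+1 = \sum_(m <- index_iota 1 M.+1) Xc (n.+1%:Z, m%:Z) w / M%:R.
Proof.
have M0' : M%:R != 0 :> R by rewrite pnatr_eq0 -lt0n.
rewrite /noise /batch_mean /Xc -mulr_suml sumrB sumr_const_nat subn1/= -mulr_natr.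
by field.
Qed.

Let noise_sqr_le w n :
  noise w n.+1 ^+ 2 <= \sum_(m <- index_iota 1 M.+1) Xc (n.+1%:Z, m%:Z) w ^+ 2 / M%:R.
Proof.
have M0' : 0 < M%:R :> R by rewrite ltr0n.
rewrite noiseE; apply: le_trans (sqr_sum_le _ _) _.
rewrite size_iota subn1/= mulr_sumr le_eqVlt; apply/orP; left; apply/eqP.
by apply: eq_bigr => m _; field; rewrite gt_eqF.
Qed.

(** The batch noise is spread over its samples, so that each summand is a past factor times a
    function of one fresh sample. *)
Let lyapunov_step n w : U n.+1 w <= U n w
  + \sum_(m <- index_iota 1 M.+1) (Z n w / M%:R) * Xc (n.+1%:Z, m%:Z) w
  + \sum_(m <- index_iota 1 M.+1) (Q n w / M%:R) * Xc (n.+1%:Z, m%:Z) w ^+ 2.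
Proof.
have := @stopped_lyapunov _ kappa (nu 1%N) t (gs w) kappa0 (gs_range w)
  (noise w) (Theta 0%N w ord0 i - mean) n _ _ _ erefl erefl erefl.
move=> /le_trans; apply; rewrite -/(D w n) -/(s w n.+1) -/(W w n.+1) -/(Z n w) -/(Q n w) lerD//.
  rewrite lerD2l noiseE mulr_sumr; apply: ler_sum => m _.
  by rewrite mulrA mulrAC.
have Q0 : 0 <= Q n w by rewrite mulr_ge0 ?sqr_ge0.
apply: le_trans (ler_wpM2l Q0 (noise_sqr_le w n)) _.
by rewrite mulr_sumr; apply: ler_sum => m _; rewrite mulrA mulrAC.
Qed.

Let fresh_notin n m : (n.+1%:Z, m) \notin block B 0 n.
Proof. by rewrite mem_block ltnn andbF. Qed.

Let past_fun n (f : T -> R) :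
  measurable_fun setT (f : filtration n -> R) -> measurable_fun setT f.
Proof. exact: (sub_past_measurable_fun mX (mTheta 0)). Qed.

Let pmW n : measurable_fun setT (fun w : filtration n => W w n.+1).
Proof. exact: past_measurable_stopped_weight. Qed.

Let pms n : measurable_fun setT (fun w : filtration n => s w n.+1).
Proof. exact: past_measurable_stopped_step. Qed.

Let pmQ n : measurable_fun setT (fun w : filtration n => Q n w).
Proof.
apply: measurable_funM; first exact: pmW.
by apply: measurable_funX; apply: measurable_funM => //; exact: pms.
Qed.

Let pmZ n : measurable_fun setT (fun w : filtration n => Z n w).
Proof.
apply: measurable_funM; last exact: past_measurable_stopped_dev.
apply: measurable_funM; first exact: pmW.
have ms2 : measurable_fun setT (fun w : filtration n => 2 * kappa * s w n.+1).
  by apply: measurable_funM => //; exact: pms.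
apply: measurable_funM => //; apply: measurable_funM => //.
exact: measurable_funB.
Qed.

Let mU n : measurable_fun setT (U n).
Proof.
apply: (@past_fun n); apply: measurable_funM.
  by apply: past_measurable_stopped_weight.
by apply: measurable_funX; apply: past_measurable_stopped_dev.
Qed.

Let U0 n w : 0 <= U n w. Proof. by rewrite mulr_ge0 ?sqr_ge0. Qed.

Let iQ n : P.-integrable setT (EFin \o Q n).
Proof.
apply: (@integrable_ae_bounded _ _ _ P _ (E * 2 ^+ 2)); first exact: past_fun.
apply: aeW => w; have /andP[s0 s2] := s_range w n.
rewrite (ger0_norm (mulr_ge0 (W0 w n.+1) (sqr_ge0 _))).
have sq : (2 * kappa * s w n.+1) ^+ 2 <= 2 ^+ 2 by rewrite lerXn2r ?nnegrE.
exact: (ler_pM (W0 w n.+1) (sqr_ge0 _) (W_le w n.+1) sq).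
Qed.

(** [Z] is linear in the deviation: [|D| <= 1 + D ^+ 2], the weight is bounded below by [F^-1], and
    the remaining coefficient is at most [4 * E]. *)
Let iZ n : P.-integrable setT (EFin \o U n) -> P.-integrable setT (EFin \o Z n).
Proof.
move=> iU; pose F := expR (decay_rate kappa (nu 1%N) * t).
have iB : P.-integrable setT (EFin \o (fun w => 4 * E * (1 + F * U n w))).
  apply: integrable_RZl; apply: integrable_RD; first exact: integrable_EFin_cst.
  exact: integrable_RZl.
apply: le_integrable iB => //; first by apply/measurable_EFinP; exact: past_fun.
move=> w _; rewrite /= lee_fin.
have /andP[s0 s2] := s_range w n; have Wn1 := W_le w n.+1.
have F0 : 0 < F by exact: expR_gt0.
have E0 : 0 < E by exact: expR_gt0.
have B0 : 0 <= 4 * E * (1 + F * U n w).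
  apply: mulr_ge0; first by apply: mulr_ge0 => //; exact: ltW.
  by apply: addr_ge0 => //; apply: mulr_ge0 => //; exact: ltW.
rewrite (ger0_norm B0).
have WF : 1 <= F * W w n.
  have := stopped_weight_ge t kappa0 nu1k (gs_range w) n.
  by rewrite expRN -/F => /(ler_wpM2l (ltW F0)); rewrite divff ?gt_eqF.
have absD : `|D w n| <= 1 + F * U n w.
  apply: (@le_trans _ _ (1 + D w n ^+ 2)).
    rewrite -[D w n ^+ 2]real_normK ?num_real//.
    by have := normr_ge0 (D w n); move: `|D w n| => x x0; have := sqr_ge0 (x - 1); nra.
  by rewrite lerD2l /U mulrA ler_peMl// sqr_ge0.
rewrite normrM ler_pM// normrM (ger0_norm (W0 _ _)) mulrC ler_pM//.
rewrite normrM normrM normr_nat (ger0_norm s0).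
have : `|1 - 2 * kappa * s w n.+1| <= 1 by rewrite ler_norml; apply/andP; split; lra.
set q := `|_|; have q0 : 0 <= q by exact: normr_ge0.
nra.
Qed.

(** By independence from the past each cross term has mean 0, and each of the [M] square terms
    contributes [var / M] times the mean of [Q n]. *)
Lemma stopped_expectation_step n : P.-integrable setT (EFin \o U n) ->
  P.-integrable setT (EFin \o U n.+1) /\
  \int[P]_w U n.+1 w <= \int[P]_w U n w + var * \int[P]_w Q n w.
Proof.
move=> iU; have iZn := iZ iU.
have M0' : M%:R != 0 :> R by rewrite pnatr_eq0 -lt0n.
have scale (f : T -> R) (pm : measurable_fun setT (f : filtration n -> R)) :
    P.-integrable setT (EFin \o f) ->
    [/\ measurable_fun setT (fun w : filtration n => f w / M%:R),
      P.-integrable setT (EFin \o (fun w => f w / M%:R)) &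
      \int[P]_w (f w / M%:R) = \int[P]_w f w / M%:R].
  move=> i_f; split; first exact: measurable_funM.
    rewrite (_ : (fun w => _) = (fun w => M%:R^-1 * f w)); first exact: integrable_RZl.
    by apply/funext => w; rewrite mulrC.
  by rewrite RintegralZr.
have [mZM iZM EZM] := scale _ (@pmZ n) iZn.
have [mQM iQM EQM] := scale _ (@pmQ n) (iQ n).
have mB1 : measurable_fun setT (fun y : R => y - mean) by exact: measurable_funB.
have mB2 : measurable_fun setT (fun y : R => (y - mean) ^+ 2) by exact: measurable_funX.
have mean_mul m := past_integrable_mul mX (mTheta 0) indX indTheta (uniq_block B 0 n)
  (fresh_notin n m) mZM mB1 iZM (iXc (n.+1%:Z, m)).
have sqr_mul m := past_integrable_mul mX (mTheta 0) indX indTheta (uniq_block B 0 n)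
  (fresh_notin n m) mQM mB2 iQM (iXc2 (n.+1%:Z, m)).
have i1 m : P.-integrable setT (EFin \o (fun w => Z n w / M%:R * Xc (n.+1%:Z, m) w)).
  exact: (mean_mul m).1.
have i2 m : P.-integrable setT (EFin \o (fun w => Q n w / M%:R * Xc (n.+1%:Z, m) w ^+ 2)).
  exact: (sqr_mul m).1.
have e1 m : \int[P]_w (Z n w / M%:R * Xc (n.+1%:Z, m) w) = 0.
  by rewrite (mean_mul m).2 EXc mulr0.
have e2 m : \int[P]_w (Q n w / M%:R * Xc (n.+1%:Z, m) w ^+ 2) = var * ((\int[P]_w Q n w) / M%:R).
  by rewrite (sqr_mul m).2 EXc2 EQM mulrC.
have is1 := integrable_Rsum (index_iota 1 M.+1) (fun m : nat => i1 m%:Z).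
have is2 := integrable_Rsum (index_iota 1 M.+1) (fun m : nat => i2 m%:Z).
have iUs : P.-integrable setT (EFin \o (fun w => U n w
    + \sum_(m <- index_iota 1 M.+1) (Z n w / M%:R) * Xc (n.+1%:Z, m%:Z) w)).
  exact: integrable_RD.
have iR : P.-integrable setT (EFin \o (fun w => U n w
    + \sum_(m <- index_iota 1 M.+1) (Z n w / M%:R) * Xc (n.+1%:Z, m%:Z) w
    + \sum_(m <- index_iota 1 M.+1) (Q n w / M%:R) * Xc (n.+1%:Z, m%:Z) w ^+ 2)).
  exact: integrable_RD.
have iU1 : P.-integrable setT (EFin \o U n.+1).
  apply: le_integrable iR => //; first exact/measurable_EFinP.
  move=> w _; rewrite /= lee_fin ger0_norm//.
  by apply: le_trans (lyapunov_step n w) _; exact: ler_norm.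
split => //; apply: le_trans (le_Rintegral _ iU1 iR _) _ => //.
rewrite !RintegralD// !Rintegral_sum//.
rewrite big1_seq => [|m _]; last exact: e1.
rewrite addr0 lerD2l (eq_bigr (fun=> var * ((\int[P]_w Q n w) / M%:R))) => [|m _]; last exact: e2.
by rewrite big_const_seq count_predT size_iota subn1/= iter_addr_0 -[leLHS]mulr_natr -mulrA divfK.
Qed.

(** Iterates the one-step estimate from [U 0], which carries the factor [exp (- c t)], and bounds
    the sum of the [Q] pathwise by [sum_stopped_weight_sqr]. *)
Lemma stopped_expectation_le n k0 : (1 <= k0)%N ->
  P.-integrable setT (EFin \o U n) /\
  \int[P]_w U n w <= expR (- (decay_rate kappa (nu 1%N) * t)) *
      (\int[P]_w (Theta 0%N w ord0 i - mean) ^+ 2 + var * (4 * kappa ^+ 2 *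
        (k0%:R * (nu 1%N ^+ 2 * expR (decay_rate kappa (nu 1%N) * (k0%:R * nu 1%N))))))
    + var * (4 * kappa ^+ 2 * (E ^+ 2 / decay_rate kappa (nu 1%N))) * \int[P]_w gamma k0 w.
Proof.
move=> k01.
have iU0 : P.-integrable setT (EFin \o U 0).
  rewrite (_ : U 0 = (fun w => expR (- (decay_rate kappa (nu 1%N) * t)) *
    (Theta 0%N w ord0 i - mean) ^+ 2)); first exact: integrable_RZl.
  by apply/funext => w; rewrite /U /W /stopped_weight /= sub0r mulrN.
have EU0 : \int[P]_w U 0 w = expR (- (decay_rate kappa (nu 1%N) * t)) *
    \int[P]_w (Theta 0%N w ord0 i - mean) ^+ 2.
  rewrite -RintegralZl//; apply: eq_Rintegral => w _.
  by rewrite /U /W /stopped_weight /= sub0r mulrN.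
have [iUn EUn] : P.-integrable setT (EFin \o U n) /\
    \int[P]_w U n w <= \int[P]_w U 0 w + var * \sum_(k <- index_iota 0 n) \int[P]_w Q k w.
  elim: n => [|n [iUn EUn]]; first by rewrite big_geq// mulr0 addr0.
  have [iU1 EU1] := stopped_expectation_step iUn; split => //.
  by rewrite big_nat_recr//= mulrDr addrA; apply: le_trans EU1 _; rewrite lerD2r.
split => //; apply: le_trans EUn _.
rewrite EU0 mulrDr -addrA lerD2l -Rintegral_sum//.
set c1 := k0%:R * _; set c2 := E ^+ 2 / _; set ex := expR _.
have igam : P.-integrable setT (EFin \o gamma k0).
  apply: (@integrable_ae_bounded _ _ _ P _ (nu 1%N)); first exact: mgamma.
  by apply: aeW => w; have /andP[g0 g1] := gs_range w k01; rewrite ger0_norm// ltW.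
have igc : P.-integrable setT (EFin \o (fun w => gamma k0 w * c2)).
  rewrite (_ : (fun w => _) = (fun w => c2 * gamma k0 w)); first exact: integrable_RZl.
  by apply/funext => w; rewrite mulrC.
have iB : P.-integrable setT (EFin \o (fun w => 4 * kappa ^+ 2 * (c1 * ex + gamma k0 w * c2))).
  by apply: integrable_RZl; apply: integrable_RD => //; exact: integrable_EFin_cst.
have leQ : \int[P]_w (\sum_(k <- index_iota 0 n) Q k w) <=
    \int[P]_w (4 * kappa ^+ 2 * (c1 * ex + gamma k0 w * c2)).
  apply: le_Rintegral => //; first exact: integrable_Rsum.
  move=> w _; rewrite big_mkord.
  apply: (sum_stopped_weight_sqr kappa0 nu1k t0 (gs_range w) n k01) => m p /andP[km mp].
  apply: (gamma_noninc (th := ths w) (x := xs w) (gamma := gs w) nu_dec nu_gt0 (gamma1 w) (fun n n1 => adapt w n1)) => //.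
  exact: leq_trans k01 km.
apply: le_trans (ler_wpM2l var0 leQ) _.
rewrite (_ : \int[P]_w _ = 4 * kappa ^+ 2 * (c1 * ex + \int[P]_w gamma k0 w * c2)).
  by rewrite le_eqVlt; apply/orP; left; apply/eqP; ring.
have icc := integrable_EFin_cst P (c1 * ex).
rewrite RintegralZl//; last exact: integrable_RD.
by rewrite RintegralD// Rintegral_EFin_cst RintegralZr.
Qed.

End stopped_processes.

(** Dominated convergence: the steps are bounded by [nu 1] and tend to 0 almost surely because the
    stage is unbounded. *)
Lemma gamma_expectation_small (e : R) :
  (exists C : R, {ae P, forall w, forall j i, `|X j w ord0 i| <= C}) -> 0 < e ->
  exists2 k, (1 <= k)%N & \int[P]_w gamma k w <= e.
Proof.
move=> /stage_unbounded unb e0.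
have gam_range w n : 0 < gamma n.+1 w <= nu 1%N.
  by rewrite gE// nu_gt0 ?stage_gt0// nu_le ?stage_gt0.
have cv0 : {ae P, forall w, setT w -> (fun n => (gamma n.+1 w)%:E) @ \oo --> (0%R)%:E}.
  apply: filterS unb => w unb_w _; apply: cvg_EFin; first exact: nearW.
  apply/cvgrPdist_le => r r0; have [m m1 num] := nu_small r0.
  have [n mn] := unb_w m; near=> p.
  rewrite /= sub0r normrN ger0_norm; last by have /andP[/ltW] := gam_range w p.
  rewrite gE//; apply: le_trans (ltW num); apply: nu_le => //.
  apply: leq_trans mn _; apply: stage_nondecreasing; apply: leqW.
  by near: p; exists n.
have ig n : P.-integrable setT (EFin \o gamma n.+1).
  apply: (@integrable_ae_bounded _ _ _ P _ (nu 1%N)); first exact: mgamma.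
  by apply: aeW => w; have /andP[g0 g1] := gam_range w n; rewrite ger0_norm// ltW.
have dom : {ae P, forall w n, setT w -> (`|(gamma n.+1 w)%:E| <= (nu 1%N)%:E)%E}.
  by apply: aeW => w n _; have /andP[g0 g1] := gam_range w n; rewrite lee_fin ger0_norm// ltW.
have [_ _] := @dominated_convergence _ _ _ P setT measurableT
  (fun n w => (gamma n.+1 w)%:E) (fun=> (0%R)%:E) (fun=> (nu 1%N)%:E)
  (fun n => proj2 (measurable_EFinP _ _) (mgamma (isT : (1 <= n.+1)%N)))
  (measurable_cst _) cv0 (integrable_EFin_cst P (nu 1%N)) dom.
rewrite integral0 => /fine_cvg/cvgrPdist_le/(_ e e0)[n _ /(_ n (leqnn n)) le_e].
exists n.+1 => //; move: le_e; rewrite sub0r normrN; apply: le_trans.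
exact: ler_norm.
Unshelve. all: by end_near. Qed.

(** * The risk at the random index *)

Lemma first_hitP (p : pred nat) : (exists n, p n) ->
  p (first_hit p) /\ forall m, (m < first_hit p)%N -> ~~ p m.
Proof.
move=> ex; rewrite /first_hit; case: pselect => // h; case: ex_minnP => n pn min_n.
by split => // m; apply: contraTN => /min_n; rewrite leqNgt.
Qed.

Hypothesis nu_sum : \sum_(1 <= k < n.+1) nu k @[n --> \oo] --> +oo.

Lemma risk_le (C : R) :
  {ae P, forall w, forall j i, `|X j w ord0 i| <= C} ->
  (forall i c, P.-integrable setT (EFin \o (fun w => (Theta 0%N w ord0 i - c) ^+ 2))) ->
  exists (A : nat -> R) (b c : R), [/\ 0 <= b, 0 < c & forall t k0, 0 <= t -> (1 <= k0)%N ->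
  (\int[P]_w ((enorm (Theta (Nt gamma t w) w - meanRd P (X (1%:Z, 1%:Z)))) ^+ 2)%:E <=
   (expR (- (c * t)) * A k0 + b * \int[P]_w gamma k0 w)%:E)%E].
Proof.
move=> bndX iTheta.
pose mean i := fine (\int[P]_w (X (1%:Z, 1%:Z) w ord0 i)%:E)%E.
have nu1k : 0 < nu 1%N < kappa^-1 by exact: step_range.
have gs_range w n : (1 <= n)%N -> 0 < gs w n <= nu 1%N.
  move=> n1; rewrite /gs gE// nu_gt0 ?stage_gt0//=.
  by apply: nu_le => //; exact: stage_gt0.
pose c := decay_rate kappa (nu 1%N).
have c0 : 0 < c by exact: decay_rate_gt0.
pose var i := \int[P]_w (X (1%:Z, 1%:Z) w ord0 i - mean i) ^+ 2.
pose A k0 := \sum_(i < d) (\int[P]_w (Theta 0%N w ord0 i - mean i) ^+ 2 +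
   var i * (4 * kappa ^+ 2 * (k0%:R * (nu 1%N ^+ 2 * expR (c * (k0%:R * nu 1%N)))))).
pose b := \sum_(i < d) var i * (4 * kappa ^+ 2 * (expR (c * nu 1%N) ^+ 2 / c)).
exists A, b, c; split=> //.
  apply: sumr_ge0 => i _; apply: mulr_ge0.
    by apply: Rintegral_ge0 => w _; exact: sqr_ge0.
  apply: mulr_ge0; first by apply: mulr_ge0 => //; exact: sqr_ge0.
  by apply: divr_ge0; [exact: sqr_ge0|exact: ltW].
move=> t k0 t0 k01.
have [nt tnt] : exists nt, t <= \sum_(1 <= k < nt.+1) nu k.
  by move/cvgryPge: nu_sum => /(_ t)[n _ /(_ n (leqnn n))]; exists n.
have sum_ge w : t <= \sum_(1 <= k < nt.+1) gamma k w.
  apply: le_trans tnt _; apply: ler_sum_nat => k /andP[k1 _].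
  exact: (gamma_ge_nu (th := ths w) (x := xs w) (gamma := gs w) nu_dec nu_gt0 (gamma1 w) (fun n n1 => adapt w n1)).
pose noise i w n := batch_mean M (xs w) n i - mean i.
pose D i w := stopped_dev kappa t (gs w) (noise i w) (Theta 0%N w ord0 i - mean i) nt.
pose U i w := stopped_weight kappa (nu 1%N) t (gs w) nt * D i w ^+ 2.
have key w i : Theta (Nt gamma t w) w ord0 i - mean i = D i w /\
    t <= stopped_time t (gs w) nt.
  have [hit before] := @first_hitP (fun n => t <= \sum_(1 <= k < n.+1) gamma k w)
    (ex_intro _ nt (sum_ge w)).
  have Nle : (Nt gamma t w <= nt)%N.
    by rewrite leqNgt; apply/negP => /before; rewrite sum_ge.
  have := @stopped_dev_first_hit R kappa t (gs w) (noise i w) (Theta 0%N w ord0 i - mean i)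
    (fun n => Theta n w ord0 i - mean i) (Nt gamma t w) nt erefl _ _ hit Nle.
  case.
  - by move=> m; rewrite Theta_coord /noise /gs; ring.
  - by move=> m /before; rewrite -ltNge.
  - by [].
have riskE w : enorm (Theta (Nt gamma t w) w - meanRd P (X (1%:Z, 1%:Z))) ^+ 2 =
    \sum_(i < d) D i w ^+ 2.
  rewrite enorm_sqr; apply: eq_bigr => i _.
  by rewrite -(key w i).1 !mxE.
have UP i := @stopped_expectation_le t i t0 C bndX (iTheta i (mean i)) nt k0 k01.
have iU i : P.-integrable setT (EFin \o U i) by exact: (UP i).1.
have mD i : measurable_fun setT (D i).
  apply: (@sub_past_measurable_fun _ _ _ _ _ _ mX (mTheta 0) _ _ (block B 0 nt)).
  exact: past_measurable_stopped_dev.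
have risk_le_U w : \sum_(i < d) D i w ^+ 2 <= \sum_(i < d) U i w.
  apply: ler_sum => i _; rewrite /U ler_peMl ?sqr_ge0//.
  have := (key w i).2; rewrite -expR0 ler_expR => tS.
  by rewrite mulr_ge0 ?subr_ge0// ltW.
apply: (@le_trans _ _ (\int[P]_w (\sum_(i < d) U i w)%:E)%E).
  apply: ge0_le_integral => //.
  - by move=> w _; rewrite lee_fin sqr_ge0.
  - apply/measurable_EFinP; rewrite (_ : (fun w => _) = (fun w => \sum_(i < d) D i w ^+ 2)).
      by apply: measurable_sum => i; exact: measurable_funX.
    by apply/funext => w; rewrite riskE.
  - by have /integrableP[] := integrable_Rsum (index_enum 'I_d) iU.
  - by move=> w _; rewrite lee_fin riskE.
rewrite -(fineK (integrable_fin_num measurableT (integrable_Rsum (index_enum 'I_d) iU))) lee_fin.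
rewrite -[leLHS]/(\int[P]_w \sum_(i < d) U i w) Rintegral_sum//.
rewrite /A /b mulr_sumr mulr_suml -big_split/=.
by apply: ler_sum => i _; exact: (UP i).2.
Qed.

End adaptive_sgd.

(** * The convergence theorem *)

(** A value [nu n <= 0] would bound a tail supremum by [nu n.+1 < 0], against the limsup being 0;
    and some tail supremum lies below [e]. *)
Lemma limn_esup0_decreasing (R : realType) (nu : nat -> R) :
  (forall n, (1 <= n)%N -> nu n.+1 < nu n) ->
  limn_esup (fun n => (nu n)%:E) = 0%E ->
  (forall n, (1 <= n)%N -> 0 < nu n) /\
  (forall e, 0 < e -> exists2 n, (1 <= n)%N & nu n < e).
Proof.
move=> nu_dec; rewrite /limn_esup limf_esupE => inf0; split => [n n1|e e0].
  rewrite ltNge; apply/negP => nun.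
  suff : (0%R%:E <= (nu n.+1)%:E :> \bar R)%E.
    by rewrite lee_fin leNgt (lt_le_trans (nu_dec n n1)).
  rewrite -[X in (X <= _)%E]inf0.
  apply: (@le_trans _ _ (ereal_sup [set (nu k)%:E | k in [set k | (n.+1 <= k)%N]])).
    by apply: ereal_inf_lbound; exists [set k | (n.+1 <= k)%N] => //; exists n.+1.
  by apply: ub_ereal_sup => _ [k /= nk <-]; rewrite lee_fin nu_le.
have [_ [V [N _ NV] <-]] : exists2 y, [set ereal_sup [set (nu k)%:E | k in V] | V in \oo] y &
    (y < e%:E)%E.
  by apply: ereal_inf_lt; rewrite inf0 lte_fin.
move=> sup_e; exists (maxn 1 N); first exact: leq_maxl.
rewrite -lte_fin; apply: le_lt_trans sup_e; apply: ereal_sup_ubound.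
by exists (maxn 1 N) => //; apply: NV; exact: leq_maxr.
Qed.

Unset Implicit Arguments.

Theorem theorem7p1 (R : realType) (d : nat) (kappa : R)
  (dT : measure_display) (T : measurableType dT) (P : probability T R)
  (X : int * int -> T -> 'rV[R]_d)
  (l : 'rV[R]_d -> 'rV[R]_d -> R)
  (M Mf : nat)
  (Theta : nat -> T -> 'rV[R]_d) (gamma : nat -> T -> R)
  (nu : nat -> R) :
  (0 < d)%N -> 0 < kappa ->
  (* X_{n,m} are random variables, non-degenerate, i.i.d. *)
  (forall j, rvRd (X j)) ->
  (forall j, nondegenerate_rv P (X j)) ->
  (forall j, ident_distr P (X j) (X (1%:Z, 1%:Z))) ->
  mutually_independent P (fun j => sigma_of (X j)) ->
  (* the loss *)
  (forall th x, l th x = kappa * (enorm (th - x)) ^+ 2) ->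
  (0 < M)%N -> (0 < Mf)%N ->
  (* Theta and gamma are stochastic processes *)
  (forall n, rvRd (Theta n)) ->
  (forall n, (1 <= n)%N -> measurable_fun setT (gamma n)) ->
  (* SGD recursion *)
  (forall n w, Theta n.+1 w = Theta n w -
      (gamma n.+1 w / M%:R) *:
        \sum_(1 <= m < M.+1)
           grad (fun th => l th (X (n.+1%:Z, m%:Z) w)) (Theta n w)) ->
  (* the sequence nu *)
  (forall n, (1 <= n)%N -> nu n.+1 < nu n) ->
  limn_esup (fun n => (nu n)%:E) = 0%E ->
  (\sum_(1 <= k < n.+1) nu k @[n --> \oo] --> +oo) ->
  (* step size adaptation *)
  (forall w, gamma 1%N w = nu 1%N) -> nu 1%N < kappa^-1 ->
  (forall n w, (1 <= n)%N ->
     let Lnew := \sum_(1 <= m < Mf.+1) l (Theta n w) (X (n%:Z, - m%:Z) w) in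
     let Lold := \sum_(1 <= m < Mf.+1) l (Theta n.-1 w) (X (n%:Z, - m%:Z) w) in
     (Lnew <= Lold -> gamma n.+1 w = gamma n w) /\
     (Lold < Lnew ->
        [/\ 0 < gamma n.+1 w, gamma n.+1 w < gamma n w,
            (exists2 k, (1 <= k)%N & gamma n.+1 w = nu k) &
            (forall k, (1 <= k)%N -> 0 < nu k -> nu k < gamma n w ->
                 nu k <= gamma n.+1 w)])) ->
  (* independence of (X_{n,m}) and Theta_0 *)
  independent2 P <<s \bigcup_j sigma_of (X j) >> (sigma_of (Theta 0%N)) ->
  (* integrability *)
  (\int[P]_w (((enorm (Theta 0%N w)) ^+ 2)%:E +
       ereal_sup [set (enorm (X (n%:Z, 0%:Z) w))%:E | n in [set n : nat | (1 <= n)%N]])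
     < +oo)%E ->
  limf_esup
    (fun t : R => \int[P]_w ((enorm (Theta (Nt gamma t w) w - meanRd P (X (1%:Z, 1%:Z)))) ^+ 2)%:E)%E
    (pinfty_nbhs R) = 0%E.
Proof.
move=> d0 kappa0 mX ndX idX indX lE M0 Mf0 mTheta mgamma sgd nu_dec nu_lim nu_sum gamma1 nu1 adapt
  indTheta int_lt.
have [nu_gt0 nu_small] := limn_esup0_decreasing nu_dec nu_lim.
have [C bndX] := iid_bounded_of_integrable_sup mX (mTheta 0%N) idX indX indTheta int_lt.
have iTheta i c : P.-integrable setT (EFin \o (fun w => (Theta 0%N w ord0 i - c) ^+ 2)).
  have mTi : measurable_fun setT (fun w => Theta 0%N w ord0 i) by exact: rvRd_coord.
  have msq : measurable_fun setT (fun w => enorm (Theta 0%N w) ^+ 2).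
    by apply: measurable_funX; exact: measurable_enorm.
  have isq : P.-integrable setT (EFin \o (fun w => enorm (Theta 0%N w) ^+ 2)).
    apply/integrableP; split; first exact/measurable_EFinP.
    apply: le_lt_trans int_lt; apply: ge0_le_integral => //.
    - by apply: measurableT_comp => //; exact/measurable_EFinP.
    - exact: measurable_sqr_enorm_add_sup.
    - move=> w _; rewrite /= ger0_norm ?sqr_ge0// leeDl//.
      apply: (@le_trans _ _ (enorm (X (1%:Z, 0%:Z) w))%:E); first by rewrite lee_fin sqrtr_ge0.
      by apply: ereal_sup_ubound; exists 1%N.
  (* The dominating function comes from [(x - c) ^+ 2 <= 2 * x ^+ 2 + 2 * c ^+ 2]. *)
  have iB := integrable_RD (integrable_RZl 2 isq) (integrable_EFin_cst P (2 * c ^+ 2)).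
  apply: le_integrable iB => //.
    by apply/measurable_EFinP; apply: measurable_funX; exact: measurable_funB.
  move=> w _; rewrite /= lee_fin ger0_norm ?sqr_ge0//.
  apply: le_trans (ler_norm _).
  have Ti : Theta 0%N w ord0 i ^+ 2 <= enorm (Theta 0%N w) ^+ 2.
    by rewrite enorm_sqr (bigD1 i)//= lerDl sumr_ge0// => *; exact: sqr_ge0.
  have := sqr_ge0 (Theta 0%N w ord0 i + c); nra.
have [A [b [c [b0 c0 risk]]]] := risk_le d0 kappa0 mX idX indX lE M0 Mf0 mTheta mgamma sgd
  nu_dec nu_gt0 nu1 gamma1 adapt indTheta nu_sum bndX iTheta.
have small := gamma_expectation_small d0 kappa0 mX (ndX _) idX indX lE M0 Mf0 mTheta mgamma sgd
  nu_dec nu_gt0 nu_small nu1 gamma1 adapt indTheta (ex_intro _ C bndX).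
apply/eqP; rewrite eq_le; apply/andP; split; last first.
  apply: limf_esup_ge0 => [[x [_ h]]|t].
    by apply: (h (x + 1)); rewrite ltrDl.
  by apply: integral_ge0 => w _; rewrite lee_fin sqr_ge0.
apply/lee_addgt0Pr => e e0; rewrite add0e.
have b1 : 0 < b + 1 by rewrite ltr_wpDl.
(* First [k0] makes the step-size term at most [e / 2]; [b + 1] avoids dividing by a possibly zero
   [b]. *)
have [k0 k01 gk] := small (e / (2 * (b + 1))) (divr_gt0 e0 (mulr_gt0 (ltr0Sn _ 1) b1)).
have bg : b * \int[P]_w gamma k0 w <= e / 2.
  apply: le_trans (ler_wpM2l b0 gk) _.
  rewrite (_ : b * _ = (e / 2) * (b / (b + 1))); last by field; rewrite gt_eqF.
  by rewrite ler_piMr ?divr_ge0 ?ltW// ltr_pdivrMr// mul1r ltrDl.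
(* Chosen so that [e / 2 * (c * t1)] is the absolute value of [A k0]; beyond [t1], the inequality
   [c * t <= expR (c * t)] makes the exponential term at most [e / 2]. *)
pose t1 := 2 * `|A k0| / (e * c).
have ec0 : 0 < e * c by exact: mulr_gt0.
have t10 : 0 <= t1 by apply: divr_ge0; [exact: mulr_ge0|exact: ltW].
apply: (@le_trans _ _ (ereal_sup [set (\int[P]_w
    ((enorm (Theta (Nt gamma t w) w - meanRd P (X (1%:Z, 1%:Z)))) ^+ 2)%:E)%E | t in [set t | t1 < t]])).
  rewrite limf_esupE; apply: ereal_inf_lbound; exists [set t | t1 < t] => //.
  by exists t1; split => //; exact: num_real.
apply: ub_ereal_sup => _ [t /= t1t <-].
have t0 : 0 <= t by rewrite (le_trans t10)// ltW.
apply: le_trans (risk t k0 t0 k01) _; rewrite lee_fin.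
suff : expR (- (c * t)) * A k0 <= e / 2 by move: bg; lra.
rewrite expRN mulrC ler_pdivrMr ?expR_gt0//.
apply: le_trans (ler_norm _) _.
have -> : `|A k0| = e / 2 * (c * t1) by rewrite /t1; field; rewrite !gt_eqF.
rewrite ler_pM2l ?divr_gt0//; apply: le_trans (_ : c * t <= _).
  by rewrite ler_pM2l// ltW.
by apply: le_trans (expR_ge1Dx _); rewrite lerDr.
Qed.
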